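(* Let $d$ and $n$ be positive integers and $r\in(0,1]$. Set $$\tau_3=\max\left(1,\frac{2^{(d+1)/2}\,d\,\kappa_d}{r^d\kappa_{d-1}}\right),\quad c=\frac{2d}{(d+1)\tau_3},\quad a_n=\left(\frac{\tau_3\ln n}{n}\right)^{\frac{2}{d+1}},\quad b_n=n^{-\frac{2}{d+1}}.$$ Then $$\sup_{K\in\tilde{\mathcal{K}}_{d,r}}\mathbb{P}_K\left[\mathsf{d}_{\mathsf L}(\hat K_n,K)\ge 4a_n+4b_nx\right]\le 6^d\exp\left(-c\,x^{\frac{d+1}{2}}\right)$$ for all $x\ge 0$ with $a_n+b_nx\le 1/4$, where, under $\mathbb{P}_K$, $\hat K_n$ is the convex hull of $n$ i.i.d. points uniformly distributed in $K$.
   Context: $\kappa_p$ is the $p$-dimensional volume of the Euclidean unit ball in $\mathbb{R}^p$ ($\kappa_0=1$); $\mathsf{Vol}_d$ is $d$-dimensional volume. A convex body in $\mathbb{R}^d$ is a compact convex set with nonempty interior. The reach of a set $A\subset\mathbb{R}^d$ is the supremum of the set of real numbers $s\ge 0$ such that each $x\in A^{\complement}$ with $\rho(x,\partial A)\le s$ has a unique metric projection on $\partial A$ ($\rho$ is Euclidean distance). A convex body $K$ satisfies the $s$-rolling condition if its complement $K^{\complement}$ has reach at least $s$ (in particular, for each $x\in\partial K$ there is $a\in K$ with $x\in B_d(a,s)\subseteq K$, $B_d(a,s)$ being the closed Euclidean ball). $\tilde{\mathcal{K}}_{d,r}$ is the class of all convex bodies $K$ in $\mathbb{R}^d$ satisfying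 the $\tilde r$-rolling condition with $\tilde r=r\left(\mathsf{Vol}_d(K)/\kappa_d\right)^{1/d}$. For two sets $K,K'\subset\mathbb{R}^d$, $$\mathsf{d}_{\mathsf L}(K,K')=\inf\{\varepsilon\ge 0:\exists a\in\mathbb{R}^d,\ a+(1+\varepsilon)^{-1}(K-a)\subseteq K'\subseteq a+(1+\varepsilon)(K-a)\}$$ (with $\inf\emptyset=+\infty$). *)

(* Defs.v *)
From HB Require Import structures.
From mathcomp Require Import all_boot all_order all_algebra.
From mathcomp Require Import all_classical all_reals all_analysis.
Set Implicit Arguments.
Unset Strict Implicit.
Unset Printing Implicit Defensive.
Import Order.TTheory GRing.Theory Num.Theory.
Import numFieldNormedType.Exports.
Local Open Scope classical_set_scope.
Local Open Scope ring_scope.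

(* The library norm on row vectors is the max norm, hence an explicit Euclidean
   norm; the topologies agree, so open, closed, compact, closure and interior
   are the library's. *)
Definition enorm {R : realType} {d : nat} (x : 'rV[R]_d) : R :=
  Num.sqrt (\sum_(i < d) x ord0 i ^+ 2).

Definition eball {R : realType} {d : nat} (a : 'rV[R]_d) (s : R) :
    set 'rV[R]_d :=
  [set x | enorm (x - a) <= s].

(* R^d with its Borel sigma-algebra. *)
Definition borel_rV (R : realType) (d : nat) :=
  g_sigma_algebraType (@open 'rV[R]_d).

(* d-dimensional volume of Borel sets, as an iterated product of the Lebesgue
   measure on the line, splitting off the first coordinate; R^0 is a single
   point of volume 1. *)
Fixpoint vol {R : realType} {d : nat} : set 'rV[R]_d -> \bar R :=
  match d return set 'rV[R]_d -> \bar R with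
  | 0%N => fun A => dirac (0 : borel_rV R 0) A
  | d'.+1 => fun A =>
      product_measure1 (@lebesgue_measure R)
        (@vol R d' : set (borel_rV R d') -> \bar R)
        [set p | A (row_mx (p.1%:M : 'rV[R]_1) (p.2 : 'rV[R]_d'))]
  end.

Definition kappa (R : realType) (p : nat) : R :=
  fine (vol (eball (0 : 'rV[R]_p) 1)).

Definition convex_body {R : realType} {d : nat} (K : set 'rV[R]_d) : Prop :=
  [/\ compact K,
      convex_set (K : set (convex_lmodType 'rV[R]_d))
    & interior K !=set0].

Definition bnd {R : realType} {d : nat} (A : set 'rV[R]_d) : set 'rV[R]_d :=
  closure A `\` interior A.

Definition edist_to {R : realType} {d : nat} (x : 'rV[R]_d)
    (S : set 'rV[R]_d) : \bar R :=
  ereal_inf [set (enorm (x - y))%:E | y in S].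

Definition metric_projection {R : realType} {d : nat} (S : set 'rV[R]_d)
    (x y : 'rV[R]_d) : Prop :=
  S y /\ (enorm (x - y))%:E = edist_to x S.

Definition reach {R : realType} {d : nat} (A : set 'rV[R]_d) : \bar R :=
  ereal_sup [set s%:E | s in [set s : R | 0 <= s /\
    forall x, (~` A) x -> (edist_to x (bnd A) <= s%:E)%E ->
      exists! y, metric_projection (bnd A) x y]].

Definition rolling {R : realType} {d : nat} (s : R) (K : set 'rV[R]_d) : Prop :=
  (s%:E <= reach (~` K))%E.

Definition rolling_class {R : realType} {d : nat} (r : R) :
    set (set 'rV[R]_d) :=
  [set K | convex_body K /\
    rolling (r * (fine (vol K) / kappa R d) `^ (d%:R^-1)) K].

Definition homothety {R : realType} {d : nat} (a : 'rV[R]_d) (l : R)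
    (K : set 'rV[R]_d) : set 'rV[R]_d :=
  [set a + l *: (x - a) | x in K].

Definition dL {R : realType} {d : nat} (K K' : set 'rV[R]_d) : \bar R :=
  ereal_inf [set e%:E | e in [set e : R | 0 <= e /\
    exists a, homothety a (1 + e)^-1 K `<=` K' /\
              K' `<=` homothety a (1 + e) K]].

Definition convex_hull {R : realType} {d : nat} (S : set 'rV[R]_d) :
    set 'rV[R]_d :=
  smallest (fun A => convex_set (A : set (convex_lmodType 'rV[R]_d))) S.

Definition uniform_on {R : realType} {d : nat} {dO : measure_display}
    {O : measurableType dO} {P : probability O R} (K : set 'rV[R]_d)
    (X : {RV P >-> borel_rV R d}) : Prop :=
  forall A : set (borel_rV R d), measurable A ->
    P (X @^-1` A) = (fine (vol (A `&` K)) / fine (vol K))%:E.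

Definition independent_RVs {R : realType} {n : nat} {dO dE : measure_display}
    {O : measurableType dO} {E : measurableType dE} {P : probability O R}
    (X : 'I_n -> {RV P >-> E}) : Prop :=
  forall (J : {set 'I_n}) (A : 'I_n -> set E),
    (forall i, measurable (A i)) ->
    P (\bigcap_(i in [set` J]) (X i @^-1` A i)) =
    (\prod_(i in J) P (X i @^-1` A i))%E.

Definition iid_uniform {R : realType} {d n : nat} {dO : measure_display}
    {O : measurableType dO} {P : probability O R} (K : set 'rV[R]_d)
    (X : 'I_n -> {RV P >-> borel_rV R d}) : Prop :=
  (forall i, uniform_on K (X i)) /\ independent_RVs X.

(* Convex hull of the sample at the outcome w. *)
Definition sample_hull {R : realType} {d n : nat} {dO : measure_display}
    {O : measurableType dO} {P : probability O R}
    (X : 'I_n -> {RV P >-> borel_rV R d}) (w : O) : set 'rV[R]_d :=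
  convex_hull [set (X i w : 'rV[R]_d) | i in [set: 'I_n]].

(* Main.v *)
Require Import Defs.
From HB Require Import structures.
From mathcomp Require Import all_boot all_order all_algebra.
From mathcomp Require Import all_classical all_reals all_analysis.
From mathcomp Require Import measurable_realfun.
From mathcomp Require Import ring lra.
Set Implicit Arguments.
Unset Strict Implicit.
Unset Printing Implicit Defensive.
Import Order.TTheory GRing.Theory Num.Theory.
Import numFieldNormedType.Exports.
Local Open Scope classical_set_scope.
Local Open Scope ring_scope.

(** Let [K] be a body of the class, [s] its rolling radius and
    [e = a_n + b_n * x <= 1 / 4]. Every boundary point of [K] lies on a ball of
    radius [s] contained in [K] ([rolling_ball]); hence for every direction [u]
    the cap of [K] of outer normal [u] and depth [e / 2 * s * enorm u] contains a
    cap of such a ball, and its volume relative to [K] is at least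
    [V = c * e `^ ((d + 1) / 2)] ([cap_of_body_volume],
    [relative_cap_volume]). A direction is missed by the sample, that is, no
    point falls in this cap, with probability at most [(1 - V) ^+ n].

    It remains to pass from one direction to all of them at a cost of order
    [e ^- d] with a small constant, although [K] may be elongated and far from
    symmetric. A net is replaced by an integral. Let [C] be the polar body of [K]
    about a point [a], with gauge [u |-> supp K u - dot u a]. If the sample hull
    is far from [K] in one direction [v] of gauge 1, then [v + e / 3 *: z] is
    missed for every [z] of [C] in a cone of directions that do not turn away
    from [b - a], where [b] is the centre of the ball that touches [K] at its
    support point in direction [v] ([missed_directions]). So on the bad event the
    missed directions occupy, within the dilate [(1 + e / 3) C], a volume at least
    [(e / 3) ^+ d] times that of the part of [C] in the cone. Tonelli's theorem
    and Markov's inequality then bound the probability of the bad event by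
    [(1 + 3 / e) ^+ d * (1 - V) ^+ n] over the proportion of [C] in the cone
    ([dL_tail_bound]).

    This proportion is at least 1/5 for every possible [b] when [a] nearly
    minimizes the volume of the polar body among the centres of balls of radius
    [s] inside [K] ([exists_polar_centre]): were it smaller, moving [a] slightly
    towards [b] would decrease that volume too much. Such an [a] is an
    approximate Santalo point, found without any derivative.

    The choice of [a_n] and [b_n] makes [(1 - V) ^+ n] at most
    [n `^ (- (2 * d / (d + 1))) * expR (- (c * x `^ ((d + 1) / 2)))], whose first
    factor absorbs [e ^- d] ([numeric_bound]).

    The ingredients about volume are that [vol] is a measure, homogeneous and
    invariant under translations and reflections ([lebesgue_rV_affine],
    [lebesgue_rV_isometry]), and the slicing bound [unit_cap_volume]. The event
    itself is measurable because [dL] of the hull is below a threshold exactly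
    on a countable union of closed sets of samples ([measurable_dL_ge]). *)

(** * Euclidean geometry of row vectors *)

Definition dot {R : realType} {d : nat} (u v : 'rV[R]_d) : R :=
  \sum_(i < d) u ord0 i * v ord0 i.

Lemma dotC (R : realType) (d : nat) (u v : 'rV[R]_d) : dot u v = dot v u.
Proof. by apply: eq_bigr => i _; rewrite mulrC. Qed.

Lemma dotDl (R : realType) (d : nat) (u v w : 'rV[R]_d) :
  dot (u + v) w = dot u w + dot v w.
Proof. by rewrite -big_split/=; apply: eq_bigr => i _; rewrite mxE mulrDl. Qed.

Lemma dotZl (R : realType) (d : nat) (c : R) (u w : 'rV[R]_d) :
  dot (c *: u) w = c * dot u w.
Proof. by rewrite mulr_sumr; apply: eq_bigr => i _; rewrite mxE mulrA. Qed.

Lemma dotNl (R : realType) (d : nat) (u w : 'rV[R]_d) : dot (- u) w = - dot u w.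
Proof. by rewrite -scaleN1r dotZl mulN1r. Qed.

Lemma dotBl (R : realType) (d : nat) (u v w : 'rV[R]_d) :
  dot (u - v) w = dot u w - dot v w.
Proof. by rewrite dotDl dotNl. Qed.

Lemma dotDr (R : realType) (d : nat) (u v w : 'rV[R]_d) :
  dot w (u + v) = dot w u + dot w v.
Proof. by rewrite dotC dotDl !(dotC w). Qed.

Lemma dotZr (R : realType) (d : nat) (c : R) (u w : 'rV[R]_d) :
  dot w (c *: u) = c * dot w u.
Proof. by rewrite dotC dotZl (dotC w). Qed.

Lemma dotNr (R : realType) (d : nat) (u w : 'rV[R]_d) : dot w (- u) = - dot w u.
Proof. by rewrite dotC dotNl (dotC w). Qed.

Lemma dotBr (R : realType) (d : nat) (u v w : 'rV[R]_d) :
  dot w (u - v) = dot w u - dot w v.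
Proof. by rewrite dotDr dotNr. Qed.

Lemma dot0l (R : realType) (d : nat) (w : 'rV[R]_d) : dot 0 w = 0.
Proof. by rewrite -(scale0r 0) dotZl mul0r. Qed.

Lemma dot0r (R : realType) (d : nat) (w : 'rV[R]_d) : dot w 0 = 0.
Proof. by rewrite dotC dot0l. Qed.

Lemma dotvv_ge0 (R : realType) (d : nat) (u : 'rV[R]_d) : 0 <= dot u u.
Proof. by apply: sumr_ge0 => i _; rewrite -expr2 sqr_ge0. Qed.

Lemma enormE (R : realType) (d : nat) (u : 'rV[R]_d) :
  enorm u = Num.sqrt (dot u u).
Proof. by congr Num.sqrt; apply: eq_bigr => i _; rewrite expr2. Qed.

Lemma dotvv (R : realType) (d : nat) (u : 'rV[R]_d) : dot u u = enorm u ^+ 2.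
Proof. by rewrite enormE sqr_sqrtr// dotvv_ge0. Qed.

Lemma enorm_ge0 (R : realType) (d : nat) (u : 'rV[R]_d) : 0 <= enorm u.
Proof. exact: sqrtr_ge0. Qed.

Lemma enormN (R : realType) (d : nat) (u : 'rV[R]_d) : enorm (- u) = enorm u.
Proof. by rewrite !enormE dotNl dotNr opprK. Qed.

Lemma enorm_distC (R : realType) (d : nat) (u v : 'rV[R]_d) :
  enorm (u - v) = enorm (v - u).
Proof. by rewrite -enormN opprB. Qed.

Lemma enormZ (R : realType) (d : nat) (c : R) (u : 'rV[R]_d) :
  enorm (c *: u) = `|c| * enorm u.
Proof.
by rewrite !enormE dotZl dotZr mulrA -expr2 sqrtrM ?sqr_ge0// sqrtr_sqr.
Qed.

Lemma enorm0 (R : realType) (d : nat) : enorm (0 : 'rV[R]_d) = 0.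
Proof. by rewrite enormE dot0l sqrtr0. Qed.

Lemma coord_le_enorm (R : realType) (d : nat) (u : 'rV[R]_d) (i : 'I_d) :
  `|u ord0 i| <= enorm u.
Proof.
rewrite -sqrtr_sqr; apply: ler_wsqrtr.
rewrite (bigD1 i)//= lerDl; apply: sumr_ge0 => j _; exact: sqr_ge0.
Qed.

Lemma enorm_eq0 (R : realType) (d : nat) (u : 'rV[R]_d) :
  (enorm u == 0) = (u == 0).
Proof.
apply/eqP/eqP => [u0|->]; last exact: enorm0.
apply/rowP => i; rewrite mxE; apply/eqP; rewrite -normr_le0 -u0.
exact: coord_le_enorm.
Qed.

Lemma enorm_gt0 (R : realType) (d : nat) (u : 'rV[R]_d) :
  (0 < enorm u) = (u != 0).
Proof. by rewrite lt_def enorm_ge0 andbT enorm_eq0. Qed.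

Lemma dot_le (R : realType) (d : nat) (u v : 'rV[R]_d) :
  dot u v <= enorm u * enorm v.
Proof.
have [->|u0] := eqVneq u 0; first by rewrite dot0l enorm0 mul0r.
have [->|v0] := eqVneq v 0; first by rewrite dot0r enorm0 mulr0.
have := dotvv_ge0 (enorm v *: u - enorm u *: v).
rewrite !(dotBl, dotBr, dotZl, dotZr) !dotvv (dotC v u).
move: u0 v0; rewrite -!enorm_gt0.
move: (enorm u) (enorm v) (dot u v) => a b x a0 b0 H.
have ab : 0 < a * b by rewrite mulr_gt0.
rewrite -subr_ge0 -(pmulr_rge0 _ ab).
by nra.
Qed.

Lemma dot_le_abs (R : realType) (d : nat) (u v : 'rV[R]_d) :
  `|dot u v| <= enorm u * enorm v.
Proof.
rewrite ler_norml dot_le andbT -[X in _ <= X]opprK lerN2 -dotNl -(enormN u).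
exact: dot_le.
Qed.

Lemma enormD (R : realType) (d : nat) (u v : 'rV[R]_d) :
  enorm (u + v) <= enorm u + enorm v.
Proof.
rewrite -(ler_pXn2r (n := 2))// ?nnegrE ?addr_ge0 ?enorm_ge0//.
rewrite -dotvv dotDl !dotDr !dotvv (dotC v u).
have := dot_le u v; nra.
Qed.

Lemma enorm_trans (R : realType) (d : nat) (v u w : 'rV[R]_d) :
  enorm (u - w) <= enorm (u - v) + enorm (v - w).
Proof. by rewrite (le_trans _ (enormD _ _))// addrA subrK. Qed.

Lemma enorm_le_norm (R : realType) (d : nat) (u : 'rV[R]_d) :
  enorm u <= d%:R * `|u|.
Proof.
rewrite -(ler_pXn2r (n := 2))// ?nnegrE ?mulr_ge0 ?enorm_ge0//.
rewrite -dotvv /dot (@le_trans _ _ (\sum_(i < d) `|u| ^+ 2))//.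
  apply: ler_sum => i _; rewrite -expr2 -(real_normK (num_real _)) ler_pXn2r ?nnegrE//.
  by rewrite /Num.norm/= mx_normrE; exact: (le_bigmax _ (fun i => `|u i.1 i.2|) (ord0, i)).
rewrite sumr_const card_ord -[leLHS]mulr_natl exprMn ler_wpM2r ?sqr_ge0//.
by case: (d) => [|k]; rewrite ?expr0n// ler_eXnr// ler1n.
Qed.

Lemma norm_le_enorm (R : realType) (d : nat) (u : 'rV[R]_d) :
  `|u| <= enorm u.
Proof.
rewrite /Num.norm/= mx_normrE; apply: bigmax_le; first exact: enorm_ge0.
by case=> i j _ /=; rewrite (ord1 i); exact: coord_le_enorm.
Qed.

(** Continuity is obtained throughout from Euclidean Lipschitz bounds: the
    topology is that of the max norm, which [enorm_le_norm] compares with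
    [enorm]. *)
Lemma enorm_lipschitz_continuous (R : realType) (d : nat) (k : R)
    (f : 'rV[R]_d -> R) :
  (forall x y, `|f x - f y| <= k * enorm (x - y)) -> continuous f.
Proof.
move=> fk x; apply/(@cvgrPdist_lt _ _ _ (nbhs x) (nbhs_filter x)) => e e0.
pose c := (`|k| + 1) * (d%:R + 1).
have c0 : 0 < c by rewrite mulr_gt0// ltr_wpDl.
apply/nbhs_ballP; exists (e / c) => /=; first by rewrite divr_gt0.
move=> y; rewrite -ball_normE/= ltr_pdivlMr// mulrC => xy.
apply: (le_lt_trans (fk _ _)); apply: le_lt_trans xy.
have kc : k * d%:R <= c.
  apply: (@le_trans _ _ (`|k| * d%:R)); first by rewrite ler_wpM2r// ler_norm.
  by rewrite /c ler_pM// lerDl.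
have [k0|k0] := leP 0 k.
  apply: (le_trans (ler_wpM2l k0 (enorm_le_norm _))).
  by rewrite mulrA ler_wpM2r.
rewrite (@le_trans _ _ 0)// ?mulr_ge0 ?(ltW c0)// nmulr_rle0 ?enorm_ge0//.
Qed.

Lemma enorm_dist_continuous (R : realType) (d : nat) (a : 'rV[R]_d) :
  continuous (fun x : 'rV[R]_d => enorm (x - a)).
Proof.
apply: (@enorm_lipschitz_continuous _ _ 1) => x y; rewrite mul1r.
have := enorm_trans y x a; have := enorm_trans x y a.
rewrite (enorm_distC y x) ler_norml => H1 H2; apply/andP; split; lra.
Qed.

Lemma enorm_continuous (R : realType) (d : nat) :
  continuous (@enorm R d).
Proof.
by move=> x; have := @enorm_dist_continuous R d 0 x; under eq_fun do rewrite subr0.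
Qed.

Lemma dot_continuous (R : realType) (d : nat) (v : 'rV[R]_d) : continuous (dot v).
Proof.
apply: (@enorm_lipschitz_continuous _ _ (enorm v)) => x y.
by rewrite -dotBr dot_le_abs.
Qed.

Lemma eball_closed (R : realType) (d : nat) (a : 'rV[R]_d) (s : R) :
  closed (eball a s).
Proof.
have -> : eball a s = (fun x : 'rV[R]_d => enorm (x - a)) @^-1` [set t | t <= s] by [].
apply: closed_comp; last exact: closed_le.
by move=> x _; exact: enorm_dist_continuous.
Qed.

Lemma closed_enorm_bounded_compact (R : realType) (d : nat) (M : R)
    (A : set 'rV[R]_d) :
  closed A -> (forall x, A x -> enorm x <= M) -> compact A.
Proof.
move=> cA bA; apply: bounded_closed_compact => //.
exists M; split; first exact: num_real.
move=> N MN x /bA xM /=; apply: ltW; apply: le_lt_trans MN.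
exact: le_trans (norm_le_enorm _) xM.
Qed.

Lemma compact_enorm_bounded (R : realType) (d : nat) (A : set 'rV[R]_d) :
  compact A -> exists2 M, 0 < M & forall x, A x -> enorm x <= M.
Proof.
move=> /compact_bounded [M [_ HM]].
exists (d%:R * (`|M| + 1) + 1); first by rewrite ltr_wpDl// mulr_ge0.
move=> x Ax; apply: (le_trans (enorm_le_norm x)).
rewrite (@le_trans _ _ (d%:R * (`|M| + 1)))// ?lerDl// ler_wpM2l//.
by apply: (HM (`|M| + 1)) => //; rewrite (le_lt_trans (ler_norm M))// ltrDl.
Qed.

Lemma closest_point (R : realType) (d : nat) (S : set 'rV[R]_d) (x : 'rV[R]_d) :
  compact S -> S !=set0 ->
  exists2 y, S y & forall z, S z -> enorm (x - y) <= enorm (x - z).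
Proof.
move=> cS S0.
have [y Sy Hy] := @compact_EVT_min _ R (fun y : 'rV[R]_d => enorm (y - x)) _ S0 cS
  (continuous_subspaceT (@enorm_dist_continuous R d x)).
exists y; first by rewrite -in_setE.
by move=> z Sz; rewrite !(enorm_distC x); apply: Hy; rewrite in_setE.
Qed.

Lemma interior_eball (R : realType) (d : nat) (A : set 'rV[R]_d) (x : 'rV[R]_d) :
  interior A x <-> exists2 e, 0 < e & eball x e `<=` A.
Proof.
split=> [|[e e0 eA]].
  rewrite /interior/= => /nbhs_ballP[e /= e0 eA]; exists (e / 2); first by rewrite divr_gt0.
  move=> y xy; apply: eA; rewrite -ball_normE/= distrC.
  by rewrite (le_lt_trans (norm_le_enorm _))// (le_lt_trans xy)// ltr_pdivrMr// mulr_natr mulr2n ltrDl.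
rewrite /interior/=; apply/nbhs_ballP; exists (e / (d%:R + 1)) => /=.
  by rewrite divr_gt0// ltr_wpDl.
move=> y; rewrite -ball_normE/= distrC ltr_pdivlMr ?ltr_wpDl// => xy.
apply: eA; rewrite /eball/=; apply: (le_trans (enorm_le_norm _)).
by rewrite mulrC; apply: le_trans (ltW xy); rewrite ler_wpM2l// lerDl.
Qed.

Lemma convex_setE (R : realType) (d : nat) (A : set 'rV[R]_d) :
  convex_set (A : set (convex_lmodType 'rV[R]_d)) <->
  (forall x y t, A x -> A y -> 0 <= t -> t <= 1 -> A (t *: x + (1 - t) *: y)).
Proof.
split=> [cA x y t Ax Ay t0 t1|cA x y t].
  have t01 : (0 <= t <= 1)%R by apply/andP.
  have := cA x y (Itv01 t0 t1).
  by rewrite !in_setE; apply.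
rewrite !in_setE => Ax Ay; apply: cA => //.
Qed.

(** * Borel measurability in coordinates *)

(** An open set of matrices is the union of the boxes with rational centre and
    radius [k.+1%:R^-1] that it contains, so coordinatewise measurability is
    enough. Row vectors are the case of one row; the general case serves for the
    whole sample, seen as a matrix with one row per point. *)
Lemma measurable_preimage_open_mx (R : realType) (m n : nat)
    (dT : measure_display) (T : measurableType dT) (M : T -> 'M[R]_(m, n))
    (U : set 'M[R]_(m, n)) :
  (forall i j, measurable_fun [set: T] (fun t => M t i j)) ->
  open U -> measurable (M @^-1` U).
Proof.
move=> mM oU.
pose B (q : 'M[rat]_(m, n)) (k : nat) : set 'M[R]_(m, n) :=
  [set x | forall i j, `|x i j - ratr (q i j)| < k.+1%:R^-1].
pose P (c : 'M[rat]_(m, n) * nat) := B c.1 c.2 `<=` U.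
pose dec (c : nat) : 'M[rat]_(m, n) * nat :=
  odflt (0 : 'M[rat]_(m, n), 0%N) (unpickle c).
have UE : M @^-1` U = \bigcup_(c : nat)
    (if pselect (P (dec c)) then M @^-1` (B (dec c).1 (dec c).2) else set0).
  apply/seteqP; split=> [t /= Ut|t [c _]].
    have /nbhs_ballP[e /= e0 eU] : nbhs (M t) U by exact: open_nbhs_nbhs.
    have [k ke] : exists k, (k.+1%:R^-1 : R) < e / 2.
      have e20 : 0 < e / 2 by rewrite divr_gt0.
      have [k Hk] := ltr_add_invr e20.
      by exists k; rewrite add0r in Hk.
    have Hq i j : exists q : rat, `|M t i j - ratr q| < k.+1%:R^-1 :> R.
      have /rat_in_itvoo[q] : M t i j - k.+1%:R^-1 < M t i j + k.+1%:R^-1.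
        by rewrite ltrBlDr -addrA ltrDl addr_gt0 ?invr_gt0.
      rewrite in_itv/= => q12; exists q.
      by rewrite distrC ltr_distl.
    pose q : 'M[rat]_(m, n) := \matrix_(i, j) projT1 (cid (Hq i j)).
    exists (pickle (q, k)) => //; rewrite /dec pickleK/=.
    have Bt : B q k (M t) by move=> i j; rewrite mxE; case: cid.
    have PQ : P (q, k).
      move=> x /= Bx; apply: eU; split=> // i j.
      rewrite /ball/= (le_lt_trans (ler_distD (ratr (q i j)) _ _))//.
      rewrite (splitr e) ltrD//; first exact: lt_trans (Bt i j) ke.
      by rewrite distrC; exact: lt_trans (Bx i j) ke.
    by case: (pselect (P (q, k))).
  by case: (pselect (P (dec c))) => // PP /= /PP.
rewrite UE; apply: bigcupT_measurable => c; case: (pselect (P (dec c))) => [PP|nPP] //=.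
move: (dec c) => [q k] /=.
have -> : M @^-1` B q k = \bigcap_(c in [set: 'I_m * 'I_n])
    ((fun t => `|M t c.1 c.2 - ratr (q c.1 c.2)|) @^-1` [set z | z < k.+1%:R^-1]).
  apply/seteqP; split=> t /= H; first by move=> [i j] _; exact: H.
  by move=> i j; exact: (H (i, j)).
apply: fin_bigcap_measurable => [|[i j] _ /=]; first exact: finite_finset.
rewrite -[X in measurable X]setTI.
have mf : measurable_fun [set: T] (fun t => `|M t i j - ratr (q i j)|).
  by apply: measurableT_comp => //; apply: measurable_funB.
apply: mf => //.
have -> : [set z : R | z < k.+1%:R^-1] = `]-oo, k.+1%:R^-1[%classic.
  by apply/seteqP; split=> z; rewrite /= in_itv.
exact: measurable_itv.
Qed.

Lemma measurable_fun_borel_rV (R : realType) (d : nat)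
    (dT : measure_display) (T : measurableType dT) (f : T -> borel_rV R d) :
  (forall i, measurable_fun [set: T] (fun t => (f t : 'rV[R]_d) ord0 i)) ->
  measurable_fun [set: T] f.
Proof.
move=> mf; apply: (@measurability _ _ T (borel_rV R d) _ f (@open 'rV[R]_d)) => //.
move=> _ [U oU <-]; rewrite setTI.
by apply: (@measurable_preimage_open_mx R 1 d) => // i j; rewrite (ord1 i).
Qed.

Lemma measurable_open_rV (R : realType) (d : nat) (U : set (borel_rV R d)) :
  open (U : set 'rV[R]_d) -> measurable U.
Proof. by move=> oU; apply: sub_sigma_algebra. Qed.

Lemma measurable_closed_rV (R : realType) (d : nat) (U : set (borel_rV R d)) :
  closed (U : set 'rV[R]_d) -> measurable U.
Proof.
move=> cU; rewrite -(setCK U); apply: measurableC.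
by apply: measurable_open_rV; exact: closed_openC.
Qed.

Lemma measurable_continuous_rV (R : realType) (d : nat) (g : 'rV[R]_d -> R) :
  continuous g -> measurable_fun [set: borel_rV R d] (g : borel_rV R d -> R).
Proof.
move=> cg; apply: (measurability _ (RGenOInfty.measurableE R)) => //.
move=> _ [_ [x ->] <-]; rewrite setTI; apply: measurable_open_rV.
by apply: open_comp => // y _; exact: cg.
Qed.

Lemma measurable_halfspace (R : realType) (d : nat) (u : 'rV[R]_d) (r : R) :
  measurable ([set y | r <= dot u (y : 'rV[R]_d)] : set (borel_rV R d)).
Proof.
apply: measurable_closed_rV.
apply: (@closed_comp _ _ (dot u) [set t | r <= t]); last exact: closed_ge.
by move=> y _; exact: dot_continuous.
Qed.

Lemma measurable_coord (R : realType) (d : nat) (i : 'I_d) :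
  measurable_fun [set: borel_rV R d] (fun x : borel_rV R d => (x : 'rV[R]_d) ord0 i).
Proof. by apply: measurable_continuous_rV; exact: coord_continuous. Qed.

Lemma measurable_dot (R : realType) (d : nat) (dT : measure_display)
    (T : measurableType dT) (f g : T -> borel_rV R d) :
  measurable_fun [set: T] f -> measurable_fun [set: T] g ->
  measurable_fun [set: T] (fun t => dot (f t : 'rV[R]_d) (g t)).
Proof.
move=> mf mg; apply: measurable_sum => i; apply: measurable_funM.
  exact: (measurableT_comp (@measurable_coord R d i) mf).
exact: (measurableT_comp (@measurable_coord R d i) mg).
Qed.

(** * Volume as a measure *)

(** The map that the recursive definition of [vol] integrates along, typed so
    that [vol] in dimension [d.+1] is the image of a product measure. *)
Definition rV_cons {R : realType} {d : nat} (p : R * borel_rV R d) :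
    borel_rV R d.+1 :=
  row_mx (p.1%:M : 'rV[R]_1) (p.2 : 'rV[R]_d).

Lemma rV_cons0 (R : realType) (d : nat) (p : R * borel_rV R d) :
  (rV_cons p : 'rV[R]_d.+1) ord0 ord0 = p.1.
Proof.
have -> : ord0 = lshift d (ord0 : 'I_1) by apply/val_inj.
by rewrite (@row_mxEl _ 1 1 d) mxE eqxx mulr1n.
Qed.

Lemma rV_consS (R : realType) (d : nat) (p : R * borel_rV R d) (j : 'I_d) :
  (rV_cons p : 'rV[R]_d.+1) ord0 (lift ord0 j) = (p.2 : 'rV[R]_d) ord0 j.
Proof.
have -> : lift ord0 j = rshift 1 j by apply/val_inj.
by rewrite (@row_mxEr _ 1 1 d).
Qed.

Lemma measurable_rV_cons (R : realType) (d : nat) :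
  measurable_fun [set: R * borel_rV R d] rV_cons.
Proof.
apply: measurable_fun_borel_rV => i.
case: (unliftP ord0 i) => [j|] ->.
  under eq_fun do rewrite rV_consS.
  exact: (measurableT_comp (@measurable_coord R d j) measurable_snd).
by under eq_fun do rewrite rV_cons0; exact: measurable_fst.
Qed.

Definition cube {R : realType} {d : nat} (k : R) : set 'rV[R]_d :=
  [set y | forall i, `|y ord0 i| <= k].

Lemma cube_closed (R : realType) (d : nat) (k : R) : closed (@cube R d k).
Proof.
have -> : @cube R d k = \bigcap_(i in [set: 'I_d])
    ((fun y : 'rV[R]_d => `|y ord0 i|) @^-1` [set t | t <= k]).
  by apply/seteqP; split=> y /= H i => [_|]; exact: H.
apply: closed_bigI => i _; apply: closed_comp; last exact: closed_le.
move=> y _; apply: (continuous_comp (@coord_continuous _ 1 d ord0 i y)).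
exact: norm_continuous.
Qed.

(** The induction carries the volume of cubes because cubes exhaust the space,
    which gives the sigma-finiteness that the next product measure requires. *)
Lemma vol_measure (R : realType) (d : nat) :
  exists2 m : {sigma_finite_measure set (borel_rV R d) -> \bar R},
    (m : set (borel_rV R d) -> \bar R) = vol &
    forall k : R, 0 <= k -> m (cube k) = ((2 * k) ^+ d)%:E.
Proof.
elim: d => [|d [m mE mc]].
  exists (dirac (0 : borel_rV R 0)) => // k k0.
  by rewrite expr0 /= diracE (_ : _ \in _ = true)//; apply/mem_set => -[].
pose m' : {measure set (borel_rV R d.+1) -> \bar R} :=
  @measure_function_pushforward__canonical__measure_function_Measure _ _ _ _ _
  (product_measure1 (@lebesgue_measure R) m) _ (@measurable_rV_cons R d).
have m'E : (m' : set (borel_rV R d.+1) -> \bar R) = vol.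
  by apply/funext => A; rewrite [LHS]/= /pushforward mE.
have m'c (k : R) : 0 <= k -> m' (cube k) = ((2 * k) ^+ d.+1)%:E.
  move=> k0; rewrite [LHS]/= /pushforward.
  have -> : @rV_cons R d @^-1` cube k =
      `[(- k), k]%classic `*` (cube k : set (borel_rV R d)).
    apply/seteqP; split=> [[x y] /= H|[x y] /= [+ H] i].
      split; first by have := H ord0; rewrite rV_cons0 ler_norml in_itv.
      by move=> j; have := H (lift ord0 j); rewrite rV_consS.
    rewrite in_itv/= -ler_norml => xk.
    by case: (unliftP ord0 i) => [j|] ->; rewrite (rV_consS, rV_cons0).
  rewrite product_measure1E//=; last first.
    by apply: measurable_closed_rV; exact: cube_closed.
  rewrite mc// lebesgue_measure_itv/= lte_fin.
  case: ltP => [kk|kk].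
    by rewrite -EFinD -EFinM opprK exprS; congr EFin; ring.
  have -> : k = 0 by apply/eqP; rewrite eq_le k0 andbT; lra.
  by rewrite mul0e mulr0 expr0n.
have sf : sigma_finite setT m'.
  exists (fun k => cube k%:R) => [|k].
    apply/seteqP; split=> // y _.
    exists (Num.trunc (\sum_i `|(y : 'rV[R]_d.+1) ord0 i|)).+1 => // i.
    apply: (@le_trans _ _ (\sum_i `|(y : 'rV[R]_d.+1) ord0 i|)).
      by rewrite (bigD1 i)//= lerDl sumr_ge0.
    by rewrite ltW// truncnS_gt.
  split; last by rewrite m'c// ltry.
  by apply: measurable_closed_rV; exact: cube_closed.
exists (HB.pack_for {sigma_finite_measure set (borel_rV R d.+1) -> \bar R}
  (m' : set (borel_rV R d.+1) -> \bar R)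
  (Measure.class m') (@Measure_isSigmaFinite.Build _ _ _ m' sf)).
  exact: m'E.
exact: m'c.
Qed.

Definition lebesgue_rV (R : realType) (d : nat) :
    {sigma_finite_measure set (borel_rV R d) -> \bar R} :=
  projT1 (cid2 (vol_measure R d)).

Lemma lebesgue_rVE (R : realType) (d : nat) :
  (lebesgue_rV R d : set (borel_rV R d) -> \bar R) = vol.
Proof. by rewrite /lebesgue_rV; case: cid2. Qed.

Lemma lebesgue_rV_cube (R : realType) (d : nat) (k : R) :
  0 <= k -> lebesgue_rV R d (cube k) = ((2 * k) ^+ d)%:E.
Proof. by rewrite /lebesgue_rV; case: cid2 => //= m _ H /H. Qed.

Lemma lebesgue_rV_cons (R : realType) (d : nat) (A : set (borel_rV R d.+1)) :
  lebesgue_rV R d.+1 A =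
  product_measure1 (@lebesgue_measure R) (lebesgue_rV R d) (@rV_cons R d @^-1` A).
Proof. by rewrite !lebesgue_rVE. Qed.

Lemma lebesgue_measure_affine (R : realType) (c t : R) (A : set R) :
  0 < c -> measurable A ->
  lebesgue_measure ((fun x => c * x + t) @^-1` A) = (c^-1%:E * lebesgue_measure A)%E.
Proof.
move=> c0 mA.
have mf : measurable_fun [set: measurableTypeR R]
    ((fun x => c * x + t) : measurableTypeR R -> measurableTypeR R).
  by apply: measurable_funD => //; exact: mulrl_measurable.
have c0' : 0 <= c by exact: ltW.
pose mu : {measure set (measurableTypeR R) -> \bar R} :=
  mscale (NngNum c0')
  (@measure_function_pushforward__canonical__measure_function_Measure _ _ _ _ _
    (@lebesgue_measure R) _ mf).
have muE B : mu B = (c%:E * lebesgue_measure ((fun x => (c * x + t)%R) @^-1` B))%E.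
  by [].
rewrite (@lebesgue_measure_unique R mu _ A mA); last first.
  move=> _ [[a b] _ <-]; rewrite muE/=.
  rewrite [X in (_ * lebesgue_measure X)%E]
    (_ : _ = `](a - t) / c, (b - t) / c]%classic); last first.
    apply/seteqP; split=> x; rewrite /= !in_itv/= ltr_pdivrMr// ler_pdivlMr//.
      by move=> /andP[? ?]; apply/andP; split; lra.
    by move=> /andP[? ?]; apply/andP; split; lra.
  rewrite !lebesgue_measure_itv/= !lte_fin ltr_pM2r ?invr_gt0// ltrD2r.
  case: ifP => _; last by rewrite mule0.
  rewrite -!EFinD -EFinM; congr EFin; field; exact: lt0r_neq0.
by rewrite muE muleA -EFinM mulVf ?mul1e// gt_eqF.
Qed.

Lemma ge0_integral_affine (R : realType) (c t : R) (g : R -> \bar R) :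
  0 < c -> measurable_fun [set: R] g -> (forall x, 0 <= g x)%E ->
  (\int[lebesgue_measure]_x g (c * x + t)%R =
   c^-1%:E * \int[lebesgue_measure]_x g x)%E.
Proof.
move=> c0 mg g0.
have mf : measurable_fun [set: measurableTypeR R]
    ((fun x => c * x + t) : measurableTypeR R -> measurableTypeR R).
  by apply: measurable_funD => //; exact: mulrl_measurable.
have c0' : 0 <= c^-1 by rewrite invr_ge0 ltW.
transitivity (\int[pushforward (@lebesgue_measure R)
    ((fun x => (c * x + t)%R) : measurableTypeR R -> measurableTypeR R)]_y g y)%E.
  by rewrite (ge0_integral_pushforward mf)//= preimage_setT.
rewrite -(ge0_integral_mscale _ _ (NngNum c0'))//.
apply: eq_measure_integral => A mA _.
exact: lebesgue_measure_affine.
Qed.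

Lemma measurable_affine_rV (R : realType) (d : nat) (c : R) (t : 'rV[R]_d) :
  measurable_fun [set: borel_rV R d]
    ((fun y => c *: (y : 'rV[R]_d) + t) : borel_rV R d -> borel_rV R d).
Proof.
apply: measurable_fun_borel_rV => i.
under eq_fun do rewrite !mxE.
apply: measurable_funD => //; apply: measurable_funM => //.
exact: measurable_coord.
Qed.

Lemma measurable_preimage_affine (R : realType) (d : nat) (c : R) (t : 'rV[R]_d)
    (A : set (borel_rV R d)) :
  measurable A ->
  measurable ([set y | A (c *: (y : 'rV[R]_d) + t)] : set (borel_rV R d)).
Proof.
move=> mA; rewrite -[X in measurable X]setTI.
exact: (@measurable_affine_rV R d c t).
Qed.

(** Translation invariance and homogeneity at once, by induction on the
    dimension, one slice at a time. *)
Lemma lebesgue_rV_affine (R : realType) (d : nat) (c : R) (t : 'rV[R]_d)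
    (A : set (borel_rV R d)) :
  0 < c -> measurable A ->
  lebesgue_rV R d [set y | A (c *: (y : 'rV[R]_d) + t)] =
  ((c^-1 ^+ d)%:E * lebesgue_rV R d A)%E.
Proof.
move=> c0; elim: d t A => [|d IH] t A mA.
  rewrite expr0 mul1e; congr (lebesgue_rV R 0 _).
  apply/seteqP; split=> y /=; rewrite (_ : _ + t = y)//; apply/rowP => -[] //.
rewrite !lebesgue_rV_cons /product_measure1/=.
have mB : measurable (@rV_cons R d @^-1` A).
  by rewrite -[X in measurable X]setTI; exact: measurable_rV_cons.
pose t0 := t ord0 ord0; pose t' : 'rV[R]_d := \row_j t ord0 (lift ord0 j).
have sE (x : R) : xsection (@rV_cons R d @^-1` [set y | A (c *: (y : 'rV[R]_d.+1) + t)]) x =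
    [set y | xsection (@rV_cons R d @^-1` A) (c * x + t0) (c *: (y : 'rV[R]_d) + t')].
  apply/seteqP; split=> y; rewrite /xsection/= !in_setE/=.
    rewrite (_ : _ + t = rV_cons (c * x + t0, c *: (y : 'rV[R]_d) + t' : borel_rV R d))//.
    apply/rowP => i.
    by case: (unliftP ord0 i) => [j|] ->; rewrite [LHS]mxE [X in X + _]mxE !(rV_consS, rV_cons0)/= ?mxE.
  rewrite (_ : c *: _ + t = rV_cons (c * x + t0, c *: (y : 'rV[R]_d) + t' : borel_rV R d))//.
  apply/rowP => i.
  by case: (unliftP ord0 i) => [j|] ->; rewrite [LHS]mxE [X in X + _]mxE !(rV_consS, rV_cons0)/= ?mxE.
transitivity (\int[lebesgue_measure]_x ((c^-1 ^+ d)%:E *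
    lebesgue_rV R d (xsection (@rV_cons R d @^-1` A) (c * x + t0)%R)))%E.
  apply: eq_integral => x _; rewrite sE IH//; exact: measurable_xsection.
have mg := @measurable_fun_xsection _ _ _ _ _ (lebesgue_rV R d) _ mB.
rewrite (@ge0_integral_affine _ _ _ (fun x => (c^-1 ^+ d)%:E *
    lebesgue_rV R d (xsection (@rV_cons R d @^-1` A) x))%E)//; last 2 first.
- by apply: measurable_funeM.
- by move=> x; rewrite mule_ge0// lee_fin exprn_ge0// invr_ge0 ltW.
rewrite ge0_integralZl//; last by rewrite lee_fin exprn_ge0// invr_ge0 ltW.
by rewrite muleA -EFinM exprS.
Qed.

Lemma measure_Tonelli (d1 d2 : measure_display) (T1 : measurableType d1)
    (T2 : measurableType d2) (R : realType)
    (m1 : {sigma_finite_measure set T1 -> \bar R})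
    (m2 : {sigma_finite_measure set T2 -> \bar R}) (S : set (T1 * T2)) :
  measurable S ->
  (\int[m1]_x m2 (xsection S x) = \int[m2]_y m1 (ysection S y))%E.
Proof.
move=> mS.
have := @product_measure_unique _ _ _ _ _ m1 m2 (product_measure2 m1 m2) _ S mS.
by apply => A B mA mB; exact: product_measure2E.
Qed.

Lemma measurable_eball (R : realType) (d : nat) (a : 'rV[R]_d) (s : R) :
  measurable (eball a s : set (borel_rV R d)).
Proof. by apply: measurable_closed_rV; exact: eball_closed. Qed.

Lemma measurable_cube (R : realType) (d : nat) (k : R) :
  measurable (cube k : set (borel_rV R d)).
Proof. by apply: measurable_closed_rV; exact: cube_closed. Qed.

Lemma cube_sub_eball (R : realType) (d : nat) (k : R) :
  0 <= k -> @cube R d k `<=` eball 0 (d%:R * k).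
Proof.
move=> k0 y yk; rewrite /eball/= subr0 (le_trans (enorm_le_norm y))//.
rewrite ler_wpM2l// /Num.norm/= mx_normrE; apply: bigmax_le => // -[i j] _ /=.
by rewrite (ord1 i); exact: yk.
Qed.

Lemma lebesgue_rV_bounded (R : realType) (d : nat) (A : set (borel_rV R d))
    (M : R) :
  measurable A -> (forall x, A x -> enorm (x : 'rV[R]_d) <= M) ->
  (lebesgue_rV R d A < +oo)%E.
Proof.
move=> mA AM.
have M0 : 0 <= `|M| by [].
apply: (@le_lt_trans _ _ (lebesgue_rV R d (cube `|M|))).
  apply: le_measure; rewrite ?inE//; first exact: measurable_cube.
  move=> x /AM xM i; apply: (le_trans (coord_le_enorm _ i)).
  by rewrite (le_trans xM)// ler_norm.
by rewrite lebesgue_rV_cube// ltry.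
Qed.

Lemma lebesgue_rV_translate (R : realType) (d : nat) (t : 'rV[R]_d)
    (A : set (borel_rV R d)) :
  measurable A ->
  lebesgue_rV R d [set y | A ((y : 'rV[R]_d) + t)] = lebesgue_rV R d A.
Proof.
move=> mA; rewrite -[RHS]mul1e -(expr1n R d) -(invr1 R).
rewrite -(@lebesgue_rV_affine R d 1 t A ltr01 mA).
by congr (lebesgue_rV R d _); apply/seteqP; split=> y /=; rewrite scale1r.
Qed.

Lemma lebesgue_rV_eball_gt0 (R : realType) (d : nat) (a : 'rV[R]_d) (s : R) :
  0 < s -> (0 < lebesgue_rV R d (eball a s))%E.
Proof.
move=> s0; rewrite -(lebesgue_rV_translate a (measurable_eball a s)).
have k0 : 0 < s / (d%:R + 1) by rewrite divr_gt0// ltr_wpDl.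
apply: (@lt_le_trans _ _ (lebesgue_rV R d (cube (s / (d%:R + 1))))).
  by rewrite lebesgue_rV_cube ?ltW// lte_fin exprn_gt0// mulr_gt0.
apply: le_measure; rewrite ?inE; [exact: measurable_cube| |].
  have -> : ([set y | eball a s ((y : 'rV[R]_d) + a)] : set (borel_rV R d)) =
      eball 0 s by apply/seteqP; split=> y; rewrite /eball/= addrK subr0.
  exact: measurable_eball.
move=> y /(cube_sub_eball (ltW k0)); rewrite /eball/= addrK subr0 => H.
apply: (le_trans H); rewrite mulrA ler_pdivrMr ?ltr_wpDl// mulrC.
by rewrite ler_wpM2l ?(ltW s0)// lerDl.
Qed.

(** The classical proof that an invariant measure is unique up to a factor. With
    [B] the unit ball, Tonelli computes the measure of the pairs [(x, y)] such
    that [B y] and [A (x + H y)] in two ways: slices at fixed [y] give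
    [vol B * vol A]; slices at fixed [x], translated by [H x], become slices of
    the pairs such that [A (H y)] and [B (y - H x)], which give
    [vol (A \o H) * vol B] since [H] preserves [B]. *)
Lemma lebesgue_rV_isometry (R : realType) (d : nat) (H : 'rV[R]_d -> 'rV[R]_d)
    (A : set (borel_rV R d)) :
  (forall x y, H (x - y) = H x - H y) -> (forall x, enorm (H x) = enorm x) ->
  (forall x, H (H x) = x) ->
  measurable A -> lebesgue_rV R d [set x | A (H x)] = lebesgue_rV R d A.
Proof.
move=> HB Hn HH mA.
have H0 : H 0 = 0 by have := HB 0 0; rewrite !subrr.
have HN x : H (- x) = - H x by rewrite -sub0r HB H0 sub0r.
have HD x y : H (x + y) = H x + H y by rewrite -[y in LHS]opprK HB HN opprK.
have cH i : continuous (fun x => H x ord0 i).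
  apply: (@enorm_lipschitz_continuous _ _ 1) => x y.
  rewrite mul1r -(Hn (x - y)) HB; apply: (le_trans _ (coord_le_enorm _ i)).
  by rewrite !mxE.
have mH : measurable_fun [set: borel_rV R d] (H : borel_rV R d -> borel_rV R d).
  by apply: measurable_fun_borel_rV => i; apply: measurable_continuous_rV.
have mHA : measurable ([set x | A (H x)] : set (borel_rV R d)).
  by rewrite -[X in measurable X]setTI; exact: mH.
pose L := lebesgue_rV R d.
pose B : set (borel_rV R d) := eball 0 1.
have mB : measurable B by exact: measurable_eball.
have B0 : (0 < L B)%E by exact: lebesgue_rV_eball_gt0.
have Boo : (L B < +oo)%E.
  apply: (@lebesgue_rV_bounded R d B 1 mB) => x.
  by rewrite /B /eball/= subr0.
have BE (x : 'rV[R]_d) : B x = (enorm x <= 1) by rewrite /B /eball/= subr0.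
pose S1 : set (borel_rV R d * borel_rV R d) := [set p | B p.2 /\ A ((p.1 : 'rV[R]_d) + H p.2)].
pose S2 : set (borel_rV R d * borel_rV R d) := [set p | A (H p.2) /\ B ((p.2 : 'rV[R]_d) - H p.1)].
have mS1 : measurable S1.
  apply: measurableI.
    by rewrite -[X in measurable X]setTI; exact: measurable_snd.
  rewrite -[X in measurable X]setTI.
  apply: (_ : measurable_fun setT (fun p : borel_rV R d * borel_rV R d =>
    (p.1 : 'rV[R]_d) + H p.2 : borel_rV R d)) => //.
  apply: measurable_fun_borel_rV => i; under eq_fun do rewrite mxE.
  apply: measurable_funD.
    exact: (measurableT_comp (@measurable_coord R d i) measurable_fst).
  exact: (measurableT_comp (measurableT_comp (@measurable_coord R d i) mH) measurable_snd).
have mS2 : measurable S2.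
  apply: measurableI.
    rewrite -[X in measurable X]setTI.
    exact: (measurableT_comp mH measurable_snd).
  rewrite -[X in measurable X]setTI.
  apply: (_ : measurable_fun setT (fun p : borel_rV R d * borel_rV R d =>
    (p.2 : 'rV[R]_d) - H p.1 : borel_rV R d)) => //.
  apply: measurable_fun_borel_rV => i.
  have -> : (fun t : borel_rV R d * borel_rV R d => ((t.2 : 'rV[R]_d) - H t.1) ord0 i) =
    (fun t => (t.2 : 'rV[R]_d) ord0 i - H t.1 ord0 i).
    by apply/funext => t; rewrite !mxE.
  apply: measurable_funB.
    exact: (measurableT_comp (@measurable_coord R d i) measurable_snd).
  exact: (measurableT_comp (measurableT_comp (@measurable_coord R d i) mH) measurable_fst).
have cstI (C : set (borel_rV R d)) (k : \bar R) : (0 <= k)%E -> measurable C ->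
    (\int[L]_y ((\1_C y)%:E * k) = L C * k)%E.
  move=> k0 mC; rewrite ge0_integralZr//; last exact: measurableT_comp.
  by rewrite integral_indic// setIT.
have E1 : (\int[L]_y L (ysection S1 y) = L B * L A)%E.
  rewrite -cstI//; apply: eq_integral => y _; rewrite indicE.
  have [yB|yB] := pselect (B y).
    rewrite (mem_set yB) mul1e -(lebesgue_rV_translate (H y) mA).
    congr (L _); apply/seteqP; split=> x; rewrite /ysection/= in_setE/=.
      by case.
    by move=> Ax; split.
  rewrite memNset// mul0e (_ : ysection S1 y = set0) ?measure0//.
  by rewrite -subset0 => x; rewrite /ysection/= in_setE/= => -[].
have E2 : (\int[L]_y L (ysection S2 y) = L [set x | A (H x)] * L B)%E.
  rewrite -cstI//; apply: eq_integral => y _; rewrite indicE.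
  have [yA|yA] := pselect (A (H y)).
    rewrite (mem_set (yA : [set x | A (H x)] y)) mul1e -(lebesgue_rV_translate (- H y) mB).
    have key (x : 'rV[R]_d) : B ((y : 'rV[R]_d) - H x) = B (x + - H y).
      by rewrite !BE -(Hn (_ - H x)) HB HH enorm_distC.
    congr (L _); apply/seteqP; split=> x.
      by rewrite /ysection/= in_setE => -[_ H1]; rewrite /= -key.
    by move=> Bx; rewrite /ysection/= in_setE; split=> //; rewrite /= key.
  rewrite memNset// mul0e (_ : ysection S2 y = set0) ?measure0//.
  by rewrite -subset0 => x; rewrite /ysection/= in_setE/= => -[].
have E3 : (\int[L]_x L (xsection S1 x) = \int[L]_x L (xsection S2 x))%E.
  apply: eq_integral => x _.
  rewrite -(lebesgue_rV_translate (- H x) (measurable_xsection x mS1)).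
  have key (y : 'rV[R]_d) : (x : 'rV[R]_d) + H (y - H x) = H y.
    by rewrite HB HH addrC subrK.
  congr (L _); apply/seteqP; split=> y; rewrite /xsection/= !in_setE /S1 /S2/=;
    by rewrite key => -[].
have : (L [set x | A (H x)] * L B = L B * L A)%E.
  by rewrite -E1 -E2 -!(measure_Tonelli L L)// E3.
rewrite (muleC (L B)).
have [b b0 ->] : exists2 b : R, 0 < b & L B = b%:E.
  exists (fine (L B)); first by rewrite fine_gt0// B0.
  by rewrite fineK// ge0_fin_numE.
move=> /(congr1 (fun z => z * b^-1%:E)%E).
by rewrite -!muleA -!EFinM mulfV ?gt_eqF// !mule1.
Qed.

(** * Volume of caps of balls *)

(** The Householder reflection that exchanges [u] and minus the first basis
    vector. The sign is chosen so that the caps of outer normal [u] become the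
    parts of lowest first coordinate, which are sliced from their pole. *)
Lemma reflection_to_axis (R : realType) (d : nat) (u : 'rV[R]_d.+1) :
  enorm u = 1 ->
  exists H : 'rV[R]_d.+1 -> 'rV[R]_d.+1,
    [/\ forall x y, H (x - y) = H x - H y, forall x, enorm (H x) = enorm x,
        forall x, H (H x) = x & forall x, H x ord0 ord0 = - dot u x].
Proof.
move=> u1.
pose e : 'rV[R]_d.+1 := delta_mx ord0 ord0.
have dote (y : 'rV[R]_d.+1) : dot e y = y ord0 ord0.
  rewrite /dot (bigD1 ord0)//= mxE !eqxx mul1r big1 ?addr0// => i i0.
  by rewrite mxE (negbTE i0) andbF mul0r.
have ee : dot e e = 1 by rewrite dote mxE !eqxx.
have uu : dot u u = 1 by rewrite dotvv u1 expr1n.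
pose m := u + e.
have [m0|m0] := eqVneq m 0.
  have ue : u = - e by apply/eqP; rewrite -addr_eq0; apply/eqP.
  by exists id; split=> // x; rewrite ue dotNl dote opprK.
have mm : dot m m = 2 * dot u m.
  by rewrite /m !(dotDl, dotDr) uu ee (dotC e u); ring.
have mm0 : dot m m != 0 by rewrite dotvv sqrf_eq0 enorm_eq0.
pose H (y : 'rV[R]_d.+1) := y - (2 * dot m y / dot m m) *: m.
have dHH x y : dot (H x) (H y) = dot x y.
  rewrite /H !(dotBl, dotBr, dotZl, dotZr) (dotC x m); field.
  exact: mm0.
exists H; split.
- move=> x y; rewrite /H dotBr; apply/rowP => i; rewrite !mxE; field.
  exact: mm0.
- by move=> x; rewrite !enormE dHH.
- move=> x; rewrite /H dotBr dotZr; apply/rowP => i; rewrite !mxE; field.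
  exact: mm0.
- move=> x.
  have em : dot e m = dot m m / 2.
    by rewrite mm /m !dotDr uu ee (dotC e u); field.
  rewrite -dote /H dotBr dotZr em.
  have -> : 2 * dot m x / dot m m * (dot m m / 2) = dot m x by field.
  by rewrite /m dotDl opprD addrCA subrr addr0.
Qed.

Lemma integral_sqrt_pow (R : realType) (m : nat) (h : R) : 0 < h ->
  (\int[lebesgue_measure]_(t in `[0%R, h]) (Num.sqrt t ^+ m)%:E =
   (2 / m.+2%:R * Num.sqrt h ^+ m.+2)%:E)%E.
Proof.
move=> h0.
pose F := fun t : R => 2 / m.+2%:R * Num.sqrt t ^+ m.+2.
have cF : continuous F.
  move=> t; apply: cvgM; first exact: cvg_cst.
  apply: (@continuous_comp _ _ _ Num.sqrt (fun z => z ^+ m.+2)).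
    exact: sqrt_continuous.
  exact: exprn_continuous.
have DF (t : R) : 0 < t -> is_derive t 1 F (Num.sqrt t ^+ m).
  move=> t0.
  have FE : F = (2 / m.+2%:R) \*: ((@Num.sqrt R : R -> R) ^+ m.+2).
    by apply/funext => z; rewrite /F exprfctE.
  rewrite FE.
  apply: (is_derive_eq (is_deriveZ _ (is_deriveX m.+2 (is_derive1_sqrt t0)))).
  rewrite /GRing.scale/=.
  have s0 : Num.sqrt t != 0 by rewrite gt_eqF// sqrtr_gt0.
  have m0 : m.+2%:R != 0 :> R by rewrite pnatr_eq0.
  by rewrite exprS; move: m0; move: (m.+2%:R) (Num.sqrt t ^+ m) => a b a0; field;
    rewrite s0 a0.
rewrite (@continuous_FTC2 _ _ F)//.
- by rewrite /F sqrtr0 expr0n/= mulr0 oppr0 adde0.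
- apply: continuous_subspaceT => t.
  apply: (@continuous_comp _ _ _ Num.sqrt (fun z => z ^+ m)).
    exact: sqrt_continuous.
  exact: exprn_continuous.
- split; last 2 first.
  + by apply: cvg_at_right_filter; exact: cF.
  + by apply: cvg_at_left_filter; exact: cF.
  move=> t; rewrite in_itv/= => /andP[t0 _].
  by have [] := DF t t0.
move=> t; rewrite in_itv/= => /andP[t0 _].
by rewrite derive1E; have [_ ->] := DF t t0.
Qed.

Lemma lebesgue_rV_unit_ball (R : realType) (d : nat) :
  lebesgue_rV R d (eball 0 1) = (kappa R d)%:E.
Proof.
rewrite /kappa -lebesgue_rVE fineK//.
rewrite ge0_fin_numE//; apply: (@lebesgue_rV_bounded R d _ 1).
  exact: measurable_eball.
by move=> x; rewrite /eball/= subr0.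
Qed.

Lemma kappa_gt0 (R : realType) (d : nat) : 0 < kappa R d.
Proof. by rewrite -lte_fin -lebesgue_rV_unit_ball lebesgue_rV_eball_gt0. Qed.

Lemma lebesgue_rV_eball (R : realType) (d : nat) (a : 'rV[R]_d) (s : R) :
  0 < s -> lebesgue_rV R d (eball a s) = (s ^+ d * kappa R d)%:E.
Proof.
move=> s0.
have -> : eball a s = [set y | eball 0 1 (s^-1 *: (y : 'rV[R]_d) + - (s^-1 *: a))].
  apply/seteqP; split=> y; rewrite /eball/= subr0 -scalerBr enormZ;
  by rewrite gtr0_norm ?invr_gt0// ler_pdivrMl// mulr1.
rewrite lebesgue_rV_affine ?invr_gt0//; last exact: measurable_eball.
by rewrite invrK lebesgue_rV_unit_ball.
Qed.

(** The inequality survives at radius 0, where in dimension 0 both sides are 1. *)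
Lemma lebesgue_rV_eball_ge (R : realType) (d : nat) (a : 'rV[R]_d) (s : R) :
  0 <= s -> ((s ^+ d * kappa R d)%:E <= lebesgue_rV R d (eball a s))%E.
Proof.
rewrite le_eqVlt => /predU1P[<-|s0]; last by rewrite lebesgue_rV_eball.
case: d a => [|d] a; last by rewrite expr0n mul0r.
rewrite expr0 mul1r -lebesgue_rV_unit_ball.
apply: le_measure; rewrite ?inE; [exact: measurable_eball..|].
move=> y _; rewrite /eball/= (_ : _ - a = 0) ?enorm0//.
by apply/rowP => -[].
Qed.

Lemma measurable_axis_cap (R : realType) (d : nat) (h : R) :
  measurable ([set y | eball 0 1 y /\ (y : 'rV[R]_d.+1) ord0 ord0 <= h - 1] :
    set (borel_rV R d.+1)).
Proof.
apply: measurableI; first exact: measurable_eball.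
apply: measurable_closed_rV.
apply: (@closed_comp _ _ (fun y : 'rV[R]_d.+1 => y ord0 ord0) [set t | t <= h - 1]).
  by move=> y _; exact: coord_continuous.
exact: closed_le.
Qed.

(** Slicing the cap orthogonally to its axis: the slice at height [t] above the
    pole contains a ball of radius [Num.sqrt t], because
    [1 - (t - 1) ^+ 2 >= t] for [t] between 0 and 1. *)
Lemma unit_cap_volume (R : realType) (d : nat) (h : R) :
  0 < h -> h <= 1 ->
  ((kappa R d * (2 / d.+2%:R * Num.sqrt h ^+ d.+2))%:E <=
   lebesgue_rV R d.+1
     [set y | eball 0 1 y /\ ((y : 'rV[R]_d.+1) ord0 ord0 <= h - 1)%R])%E.
Proof.
move=> h0 h1.
set C := [set y | _].
have mC : measurable (C : set (borel_rV R d.+1)) := @measurable_axis_cap R d h.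
have mB : measurable (@rV_cons R d @^-1` C).
  by rewrite -[X in measurable X]setTI; exact: measurable_rV_cons.
have k0 := kappa_gt0 R d.
pose f (t : R) : \bar R := ((kappa R d)%:E * (Num.sqrt t ^+ d)%:E)%E.
have mf : measurable_fun [set: R] f.
  apply: measurable_funeM; apply/measurable_EFinP.
  apply: continuous_measurable_fun => t.
  apply: (@continuous_comp _ _ _ Num.sqrt (fun z => z ^+ d)).
    exact: sqrt_continuous.
  exact: exprn_continuous.
have f0 t : (0 <= f t)%E by rewrite /f -EFinM lee_fin mulr_ge0 ?exprn_ge0// ltW.
rewrite EFinM -integral_sqrt_pow// -ge0_integralZl//; last 2 first.
- apply/measurable_EFinP; apply: measurable_funTS.
  apply: continuous_measurable_fun => t.
  apply: (@continuous_comp _ _ _ Num.sqrt (fun z => z ^+ d)).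
    exact: sqrt_continuous.
  exact: exprn_continuous.
- by rewrite lee_fin ltW.
rewrite integral_mkcond.
pose g := f \_ `[0%R, h].
have mg : measurable_fun [set: R] g.
  by apply/(measurable_restrictT f (measurable_itv `[0%R, h])); exact: measurable_funTS.
have g0 t : (0 <= g t)%E by rewrite /g patchE; case: ifP.
rewrite -[leLHS]mul1e -[X in (X%:E * _)%E]invr1.
rewrite -(ge0_integral_affine 1 ltr01 mg g0) lebesgue_rV_cons.
apply: ge0_le_integral => //.
- apply: (measurableT_comp mg); exact: measurable_funD.
- exact: (@measurable_fun_xsection _ _ _ _ _ (lebesgue_rV R d) _ mB).
move=> x _; rewrite mul1r /g patchE; case: ifPn; last by move=> _; exact: measure_ge0.
rewrite inE/= in_itv/= => /andP[x0 xh].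
rewrite /f -EFinM mulrC.
apply: le_trans (lebesgue_rV_eball_ge 0 (sqrtr_ge0 (x + 1))) _.
apply: le_measure; rewrite ?inE; [exact: measurable_eball|exact: measurable_xsection|].
move=> y; rewrite /eball/= subr0 => yx; rewrite /xsection/= in_setE/=.
split; last by rewrite rV_cons0/=; lra.
rewrite /eball/= subr0 -(ler_pXn2r (n := 2))// ?nnegrE ?enorm_ge0// expr1n.
rewrite -dotvv /dot big_ord_recl rV_cons0/=.
under eq_bigr do rewrite rV_consS/=.
rewrite -/(dot (y : 'rV[R]_d) y) dotvv.
have : enorm (y : 'rV[R]_d) ^+ 2 <= x + 1.
  by rewrite -(sqr_sqrtr x0) ler_pXn2r// ?nnegrE ?enorm_ge0.
by nra.
Qed.

Lemma cap_volume (R : realType) (d : nat) (b u : 'rV[R]_d.+1) (s h : R) :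
  u != 0 -> 0 < s -> 0 < h -> h <= 1 ->
  ((s ^+ d.+1 * (kappa R d * (2 / d.+2%:R * Num.sqrt h ^+ d.+2)))%:E <=
   lebesgue_rV R d.+1 [set y | eball b s y /\
     (dot u b + s * enorm u * (1 - h) <= dot u (y : 'rV[R]_d.+1))%R])%E.
Proof.
move=> u0 s0 h0 h1.
have nu : 0 < enorm u by rewrite enorm_gt0.
have u1 : enorm ((enorm u)^-1 *: u) = 1.
  by rewrite enormZ gtr0_norm ?invr_gt0// mulVf// gt_eqF.
have [H [HB Hn HH H1]] := reflection_to_axis u1.
pose C : set (borel_rV R d.+1) :=
  [set y | eball 0 1 y /\ (y : 'rV[R]_d.+1) ord0 ord0 <= h - 1].
have mC : measurable C := @measurable_axis_cap R d h.
have cH i : continuous (fun x => H x ord0 i).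
  apply: (@enorm_lipschitz_continuous _ _ 1) => x y.
  rewrite mul1r -(Hn (x - y)) HB; apply: (le_trans _ (coord_le_enorm _ i)).
  by rewrite !mxE.
have mHC : measurable ([set z | C (H z)] : set (borel_rV R d.+1)).
  rewrite -[X in measurable X]setTI.
  apply: (_ : measurable_fun setT (H : borel_rV R d.+1 -> borel_rV R d.+1)) => //.
  by apply: measurable_fun_borel_rV => i; apply: measurable_continuous_rV.
have -> : [set y | eball b s y /\ dot u b + s * enorm u * (1 - h) <= dot u y] =
    [set y | [set z | C (H z)] (s^-1 *: (y : 'rV[R]_d.+1) + - (s^-1 *: b))].
  have keyB (y : 'rV[R]_d.+1) : enorm (H (s^-1 *: y - s^-1 *: b)) <= 1 <->
      enorm (y - b) <= s.
    by rewrite -scalerBr Hn enormZ gtr0_norm ?invr_gt0// ler_pdivrMl// mulr1.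
  have keyC (y : 'rV[R]_d.+1) : H (s^-1 *: y - s^-1 *: b) ord0 ord0 <= h - 1 <->
      dot u b + s * enorm u * (1 - h) <= dot u y.
    rewrite H1 -scalerBr dotZl dotZr dotBr lerNl opprB mulrA -invfM mulrC.
    by rewrite ler_pdivlMr ?mulr_gt0// (mulrC (enorm u)) lerBrDl (mulrC (1 - h)).
  apply/seteqP; split=> y; rewrite /C /eball/= subr0 => -[By Cy]; split.
  - exact/keyB.
  - exact/keyC.
  - exact/keyB.
  - exact/keyC.
rewrite lebesgue_rV_affine ?invr_gt0// invrK (lebesgue_rV_isometry HB Hn HH mC).
by rewrite EFinM lee_pmul2l// ?lte_fin ?exprn_gt0//; exact: unit_cap_volume.
Qed.

(** * From reach to rolling balls *)

Lemma closure_enormP (R : realType) (d : nat) (A : set 'rV[R]_d) (y : 'rV[R]_d) :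
  closure A y <-> forall e, 0 < e -> exists2 w, A w & enorm (w - y) <= e.
Proof.
split=> [cA e e0|H B yB].
  have /cA[w [Aw yw]] : nbhs y (eball y e).
    have : interior (eball y e) y by apply/interior_eball; exists e.
    by [].
  by exists w.
have /interior_eball[e e0 eB] : interior B y by [].
by have [w Aw yw] := H e e0; exists w; split=> //; exact: eB.
Qed.

Lemma bnd_setCE (R : realType) (d : nat) (K : set 'rV[R]_d) :
  closed K -> bnd (~` K) = K `&` closure (~` K).
Proof.
move=> cK; rewrite /bnd (_ : interior (~` K) = ~` K); last first.
  by apply/interior_id; exact: closed_openC.
by rewrite setDE setCK setIC.
Qed.

Lemma bnd_setC_compact (R : realType) (d : nat) (K : set 'rV[R]_d) :
  compact K -> compact (bnd (~` K)).
Proof.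
move=> cK; have clK := compact_closed (@norm_hausdorff _ _) cK.
rewrite bnd_setCE//; apply: compact_closedI => //; exact: closed_closure.
Qed.

(** The boundary point is the point of [K] on the segment that is nearest to
    [z]; it differs from [z], whence the strict inequality. *)
Lemma segment_meets_bnd (R : realType) (d : nat) (K : set 'rV[R]_d)
    (x z : 'rV[R]_d) :
  closed K -> K x -> ~ K z ->
  exists2 y, bnd (~` K) y & enorm (x - y) < enorm (x - z).
Proof.
move=> cK Kx Kz.
pose f (t : R) : 'rV[R]_d := x + t *: (z - x).
have cf : continuous f.
  move=> t; apply: cvgD; first exact: cvg_cst.
  by apply: cvgZl; exact: cvg_id.
have cS : compact (K `&` f @` `[0, 1]).
  rewrite setIC; apply: compact_closedI => //.
  by apply: continuous_compact; [exact: continuous_subspaceT|exact: segment_compact].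
have [|y [Ky [t t01 tE]] ymin] := @closest_point R d _ z cS.
  exists x; split=> //; exists 0; first by rewrite /= in_itv/= lexx ler01.
  by rewrite /f scale0r addr0.
move: t01; rewrite /= in_itv/= => /andP[t0 t1].
have zx : z - x != 0 by apply/eqP => /subr0_eq zx; apply: Kz; rewrite zx.
have {}t1 : t < 1.
  rewrite lt_neqAle t1 andbT; apply/eqP => tt; apply: Kz; move: Ky.
  by rewrite -tE /f tt scale1r addrC subrK.
exists y; last first.
  rewrite -tE /f opprD addrA subrr add0r -scaleNr enormZ normrN ger0_norm//.
  by rewrite (enorm_distC x) gtr_pMl// enorm_gt0.
rewrite bnd_setCE//; split=> //; apply/closure_enormP => e e0.
pose u := Num.min (1 - t) (e / enorm (z - x)).
have u0 : 0 < u by rewrite lt_min subr_gt0 t1 divr_gt0// enorm_gt0.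
exists (f (t + u)).
  move=> Kf; have : enorm (z - y) <= enorm (z - f (t + u)).
    apply: ymin; split=> //; exists (t + u) => //.
    rewrite /= in_itv/= addr_ge0 ?(ltW u0)//= -lerBrDl.
    by rewrite ge_min lexx.
  rewrite -tE.
  have fE (r : R) : z - f r = (1 - r) *: (z - x).
    by apply/rowP => i; rewrite !mxE; ring.
  rewrite !fE !enormZ ler_pM2r ?enorm_gt0//.
  rewrite !ger0_norm; [lra| |lra].
  by rewrite opprD addrA subr_ge0 ge_min lexx.
rewrite -tE (_ : _ - _ = u *: (z - x)); last by apply/rowP => i; rewrite !mxE; ring.
rewrite enormZ gtr0_norm// -ler_pdivlMr ?enorm_gt0//.
by rewrite ge_min lexx orbT.
Qed.

Lemma eball_le_bnd (R : realType) (d : nat) (K : set 'rV[R]_d) (x y : 'rV[R]_d)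
    (r : R) :
  closed K -> eball x r `<=` K -> bnd (~` K) y -> r <= enorm (x - y).
Proof.
move=> cK xK; rewrite bnd_setCE// => -[_ /closure_enormP yK].
rewrite leNgt; apply/negP => xy.
have [w Kw wy] := yK (r - enorm (x - y)) ltac:(by rewrite subr_gt0).
apply: Kw; apply: xK; rewrite /eball/= (le_trans (enorm_trans y _ _))//.
by rewrite (enorm_distC y x) -lerBrDr.
Qed.

(** Real-valued because [edist_to] is finite on a nonempty set. *)
Definition dist_to {R : realType} {d : nat} (S : set 'rV[R]_d) (x : 'rV[R]_d) : R :=
  fine (edist_to x S).

Lemma dist_to_proj (R : realType) (d : nat) (S : set 'rV[R]_d) (x y : 'rV[R]_d) :
  S y -> (forall z, S z -> enorm (x - y) <= enorm (x - z)) ->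
  edist_to x S = (enorm (x - y))%:E.
Proof.
move=> Sy ymin; apply/eqP; rewrite eq_le; apply/andP; split.
  by apply: ereal_inf_lbound; exists y.
by apply: le_ereal_inf_tmp => _ [z Sz <-]; rewrite lee_fin ymin.
Qed.

Lemma dist_toP (R : realType) (d : nat) (S : set 'rV[R]_d) (x : 'rV[R]_d) :
  compact S -> S !=set0 ->
  exists y, [/\ S y, dist_to S x = enorm (x - y),
    edist_to x S = (dist_to S x)%:E &
    forall z, S z -> dist_to S x <= enorm (x - z)].
Proof.
move=> cS S0; have [y Sy ymin] := closest_point x cS S0.
by exists y; rewrite /dist_to (dist_to_proj Sy ymin); split.
Qed.

Lemma dist_to_le (R : realType) (d : nat) (S : set 'rV[R]_d) (x y : 'rV[R]_d) :
  compact S -> S y -> dist_to S x <= enorm (x - y).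
Proof.
move=> cS Sy; have S0 : S !=set0 by exists y.
by have [z [_ _ _]] := dist_toP x cS S0; apply.
Qed.

Lemma dist_to_lipschitz (R : realType) (d : nat) (S : set 'rV[R]_d)
    (x y : 'rV[R]_d) :
  compact S -> S !=set0 -> dist_to S x <= dist_to S y + enorm (x - y).
Proof.
move=> cS S0; have [z [Sz -> _ _]] := dist_toP y cS S0.
by rewrite (le_trans (dist_to_le x cS Sz))// [leRHS]addrC enorm_trans.
Qed.

Lemma dist_to_continuous (R : realType) (d : nat) (S : set 'rV[R]_d) :
  compact S -> S !=set0 -> continuous (dist_to S).
Proof.
move=> cS S0; apply: (@enorm_lipschitz_continuous _ _ 1) => x y.
have := dist_to_lipschitz x y cS S0; have := dist_to_lipschitz y x cS S0.
by rewrite mul1r (enorm_distC y) ler_norml => ? ?; apply/andP; split; lra.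
Qed.

(** If [y] is the only nearest point of [S], moving away from it increases the
    distance at a rate as close to 1 as desired: the points of [S] seen from [x]
    in nearly the direction of [y] recede at that rate, and the others form a
    compact set at a larger distance. *)
Lemma dist_to_growth (R : realType) (d : nat) (S : set 'rV[R]_d)
    (x y : 'rV[R]_d) (k : R) :
  compact S -> S y -> 0 < enorm (x - y) -> 0 < k -> k < 1 ->
  (forall z, S z -> enorm (x - y) <= enorm (x - z)) ->
  (forall z, S z -> enorm (x - z) <= enorm (x - y) -> z = y) ->
  exists2 t0, 0 < t0 & forall t, 0 < t -> t <= t0 ->
    dist_to S x + (1 - k) * t <=
    dist_to S (x + t *: ((enorm (x - y))^-1 *: (x - y))).
Proof.
move=> cS Sy D0 k0 k1 ymin yuniq.
have S0 : S !=set0 by exists y.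
have clS := compact_closed (@norm_hausdorff _ _) cS.
set D := enorm (x - y) in D0 ymin yuniq *; set e := D^-1 *: (x - y).
have e1 : enorm e = 1.
  by rewrite /e enormZ gtr0_norm ?invr_gt0// mulVf// gt_eqF.
have dSx : dist_to S x = D by rewrite /dist_to (dist_to_proj Sy ymin).
pose S' := S `&` [set z | dot e (x - z) <= (1 - k) * enorm (x - z)].
have cS' : compact S'.
  apply: compact_closedI => //.
  pose g (z : 'rV[R]_d) := dot e z + (1 - k) * enorm (z - x).
  have -> : [set z | dot e (x - z) <= (1 - k) * enorm (x - z)] =
      g @^-1` [set t | dot e x <= t].
    by apply/seteqP; split=> z; rewrite /g/= dotBr (enorm_distC x) => ?; lra.
  apply: closed_comp; last exact: closed_ge.
  move=> z _; apply: continuousD; first exact: dot_continuous.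
  apply: continuousM; first exact: cst_continuous.
  exact: enorm_dist_continuous.
have [t0 t00 Ht0] : exists2 t0, 0 < t0 & forall z, S' z -> D + 2 * t0 <= enorm (x - z).
  have [S'0|S'0] := pselect (S' !=set0); last first.
    by exists 1 => // z S'z; exfalso; apply: S'0; exists z.
  have [w [Sw ew] wmin] := closest_point x cS' S'0.
  have Dw : D < enorm (x - w).
    rewrite lt_neqAle ymin// andbT; apply/eqP => Dw.
    have wy : w = y by apply: yuniq => //; rewrite -Dw.
    move: ew; rewrite /= wy -/D dotC /e dotZr dotvv -/D.
    rewrite expr2 mulrA mulVf ?gt_eqF// mul1r.
    by rewrite leNgt gtr_pMl//; move: k0; clear; lra.
  exists ((enorm (x - w) - D) / 2); first by rewrite divr_gt0 ?subr_gt0.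
  by move=> z /wmin; apply: le_trans; rewrite mulrC divfK// addrC subrK.
exists t0 => // t tt0 tlt.
have [z [Sz -> _ _]] := dist_toP (x + t *: e) cS S0.
rewrite dSx.
have [zS'|zS'] := leP (dot e (x - z)) ((1 - k) * enorm (x - z)).
  have := Ht0 z (conj Sz zS').
  have : enorm (x - z) <= enorm (x + t *: e - z) + t.
    rewrite (le_trans (enorm_trans (x + t *: e) _ _))// [leRHS]addrC lerD2r.
    by rewrite opprD addrA subrr add0r enormN enormZ e1 mulr1 gtr0_norm.
  by nra.
have xz0 : 0 < enorm (x - z) by apply: (lt_le_trans D0); exact: ymin.
have H : enorm (x - z) ^+ 2 + t * dot e (x - z) <=
    enorm (x + t *: e - z) * enorm (x - z).
  by have := dot_le (x + t *: e - z) (x - z); rewrite {1}addrAC dotDl dotvv dotZl.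
rewrite -(ler_pM2r xz0); apply: le_trans H.
have : t * ((1 - k) * enorm (x - z)) <= t * dot e (x - z) by rewrite ler_pM2l// ltW.
have : D * enorm (x - z) <= enorm (x - z) ^+ 2 by rewrite expr2 ler_pM2r// ymin.
by clear; nra.
Qed.

(** Steepest ascent of the distance to the boundary. Maximizing
    [dist - (1 - k) * enorm (_ - x)] over the points of depth at most [t]
    leads to depth exactly [t], since by [dist_to_growth] the distance would
    otherwise still increase at a rate larger than [1 - k]. *)
Lemma deep_point_near_bnd (R : realType) (d : nat) (K : set 'rV[R]_d)
    (p : 'rV[R]_d) (t e : R) :
  convex_body K -> bnd (~` K) p -> 0 < t -> 0 < e ->
  (forall x, K x -> dist_to (bnd (~` K)) x <= t ->
    exists! y, metric_projection (bnd (~` K)) x y) ->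
  exists2 b, K b & dist_to (bnd (~` K)) b = t /\ enorm (b - p) <= t + e.
Proof.
move=> [cK vK [i0 /interior_eball[q q0 qK]]] Sp t0 e0 uniq.
have clK := compact_closed (@norm_hausdorff _ _) cK.
set S := bnd (~` K) in Sp uniq *.
have cS : compact S by exact: bnd_setC_compact.
have S0 : S !=set0 by exists p.
have Kp : K p by move: Sp; rewrite /S bnd_setCE// => -[].
move/convex_setE : vK => vK.
pose c := Num.min (e / 2) t.
have c0 : 0 < c by rewrite lt_min divr_gt0.
(* [x] lies on the segment from [p] to an interior point, within [c] of [p]:
   this keeps its depth positive and at most [t]. *)
pose u := c / (c + enorm (i0 - p)).
have cp0 : 0 < c + enorm (i0 - p) by rewrite ltr_wpDr// enorm_ge0.
have u0 : 0 < u by rewrite divr_gt0.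
have u1 : u <= 1 by rewrite ler_pdivrMr// mul1r lerDl enorm_ge0.
have uc : u * enorm (i0 - p) <= c.
  rewrite /u mulrAC ler_pdivrMr// ler_pM2l// lerDr; exact: ltW.
pose x := p + u *: (i0 - p).
have xK : eball x (u * q) `<=` K.
  move=> w; rewrite /eball/= => wx.
  have -> : w = u *: (i0 + u^-1 *: (w - x)) + (1 - u) *: p.
    rewrite scalerDr scalerA mulfV ?gt_eqF// scale1r /x.
    by apply/rowP => i; rewrite !mxE; ring.
  apply: vK => //; last exact: ltW.
  apply: qK; rewrite /eball/= addrAC subrr add0r enormZ gtr0_norm ?invr_gt0//.
  by rewrite ler_pdivrMl.
have Kx : K x by apply: xK; rewrite /eball/= subrr enorm0 mulr_ge0 ?ltW.
have dx0 : 0 < dist_to S x.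
  have [y [Sy -> _ _]] := dist_toP x cS S0.
  by apply: (lt_le_trans (mulr_gt0 u0 q0)); exact: eball_le_bnd xK Sy.
have xp : enorm (x - p) <= c by rewrite /x addrAC subrr add0r enormZ gtr0_norm.
have dxt : dist_to S x <= t.
  by rewrite (le_trans (dist_to_le x cS Sp))// (le_trans xp)// ge_min lexx orbT.
(* The slope loss for which [t / (1 - k) = t + e / 2]. *)
pose k := (e / 2) / (t + e / 2).
have te0 : 0 < t + e / 2 by rewrite addr_gt0// divr_gt0.
have k0 : 0 < k by rewrite divr_gt0// divr_gt0.
have k1 : k < 1 by rewrite ltr_pdivrMr// mul1r ltrDr.
have kE : (1 - k) * (t + e / 2) = t.
  by rewrite mulrBl mul1r /k divfK ?addrK// gt_eqF.
have cd := dist_to_continuous cS S0.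
pose Z := K `&` (dist_to S @^-1` [set r | r <= t]).
have cZ : compact Z.
  apply: compact_closedI => //; apply: closed_comp; last exact: closed_le.
  by move=> z _; exact: cd.
pose f z := dist_to S z - (1 - k) * enorm (z - x).
have cf : continuous f.
  move=> z; apply: continuousB; first exact: cd.
  by apply: continuousM; [exact: cst_continuous|exact: enorm_dist_continuous].
have Z0 : Z !=set0 by exists x.
have [b + bmax] := @compact_EVT_max _ R f _ Z0 cZ (continuous_subspaceT cf).
rewrite in_setE => -[Kb /= dbt].
have fx : dist_to S x <= dist_to S b - (1 - k) * enorm (b - x).
  have := bmax x; rewrite in_setE => /(_ (conj Kx dxt)).
  by rewrite /f subrr enorm0 mulr0 subr0.
have kbx : 0 <= (1 - k) * enorm (b - x).
  by rewrite mulr_ge0 ?enorm_ge0// subr_ge0 ltW.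
have db0 : 0 < dist_to S b by move: dx0 fx kbx; clear; lra.
have dbE : dist_to S b = t.
  apply/eqP; rewrite eq_le dbt/= leNgt; apply/negP => dblt.
  have [y [Sy dby edb dbz]] := dist_toP b cS S0.
  have [y' [_ yuniq]] := uniq b Kb dbt.
  have yproj z : S z -> enorm (b - z) <= enorm (b - y) -> z = y.
    move=> Sz zy.
    have <- : y' = z.
      apply: yuniq; split=> //; rewrite edb; congr EFin.
      by apply/eqP; rewrite eq_le dbz// dby zy.
    by apply: yuniq; split=> //; rewrite edb dby.
  have k20 : 0 < k / 2 by rewrite divr_gt0.
  have k21 : k / 2 < 1 by move: k0 k1; clear; lra.
  have yb0 : 0 < enorm (b - y) by rewrite -dby.
  have ymin z : S z -> enorm (b - y) <= enorm (b - z) by rewrite -dby; exact: dbz.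
  have [v v0 Hv] := dist_to_growth cS Sy yb0 k20 k21 ymin yproj.
  pose w := Num.min v (Num.min (t - dist_to S b) (dist_to S b)).
  have w0 : 0 < w by rewrite !lt_min v0 subr_gt0 dblt.
  have wv : w <= v by rewrite ge_min lexx.
  have wt : w <= t - dist_to S b by rewrite !ge_min lexx !orbT.
  have wd : w <= dist_to S b by rewrite !ge_min lexx !orbT.
  have := Hv w w0 wv; set z := b + _ => zgrow.
  have zb : enorm (z - b) = w.
    rewrite /z addrAC subrr add0r !enormZ gtr0_norm// gtr0_norm ?invr_gt0//.
    by rewrite mulVf ?mulr1// gt_eqF.
  have Kz : K z.
    apply: contrapT => Kz; have [y1 Sy1] := segment_meets_bnd clK Kb Kz.
    by rewrite ltNge enorm_distC zb (le_trans wd)// dbz.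
  have zt : dist_to S z <= t.
    have := dist_to_lipschitz z b cS S0; rewrite zb; move: wt; clear; lra.
  have := bmax z; rewrite in_setE => /(_ (conj Kz zt)); rewrite /f.
  have := enorm_trans b z x; rewrite zb.
  move: zgrow w0 k0 k1; clear; nra.
exists b => //; split=> //.
have bx : enorm (b - x) <= t + e / 2.
  have k10 : 0 < 1 - k by rewrite subr_gt0.
  rewrite -(ler_pM2l k10) kE; move: fx dx0; rewrite dbE; clear; lra.
rewrite (le_trans (enorm_trans x _ _))//.
have : enorm (x - p) <= e / 2 by rewrite (le_trans xp)// ge_min lexx.
by move: bx; clear; lra.
Qed.

(** A ball of radius exactly [s] through [p]: centres given by
    [deep_point_near_bnd] for depths tending to [s] make the nonnegative function
    [enorm (b - p) - dist b + `|dist b - s|] arbitrarily small, and it attains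
    its minimum on [K]. *)
Lemma rolling_ball (R : realType) (d : nat) (K : set 'rV[R]_d)
    (p : 'rV[R]_d) (s : R) :
  convex_body K -> rolling s K -> 0 < s -> bnd (~` K) p ->
  exists2 b, eball b s `<=` K & enorm (b - p) <= s.
Proof.
move=> bK roll s0 Sp.
have [cK _ _] := bK.
have clK := compact_closed (@norm_hausdorff _ _) cK.
have cS := bnd_setC_compact cK.
set S := bnd (~` K) in Sp cS *.
have S0 : S !=set0 by exists p.
have uniq t : t < s -> forall x, K x -> dist_to S x <= t ->
    exists! y, metric_projection S x y.
  move=> ts x Kx dxt.
  have : (t%:E < reach (~` K))%E by apply: lt_le_trans roll; rewrite lte_fin.
  move=> /ereal_sup_gt[_ [t' [t'0 Ht'] <-]]; rewrite lte_fin => tt'.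
  apply: Ht'; first by rewrite setCK.
  have [y [_ _ -> _]] := dist_toP x cS S0.
  by rewrite lee_fin (le_trans dxt)// ltW.
pose g (b : 'rV[R]_d) : R :=
  (enorm (b - p) - dist_to S b) + `|dist_to S b - s|.
have cg : continuous g.
  have cd := dist_to_continuous cS S0.
  have c1 : continuous (fun b : 'rV[R]_d => enorm (b - p) - dist_to S b).
    move=> b.
    apply: (@continuousB R R^o _ (fun b : 'rV[R]_d => enorm (b - p)) (dist_to S)).
      exact: enorm_dist_continuous.
    exact: cd.
  have c2 : continuous (fun b : 'rV[R]_d => `|dist_to S b - s|).
    move=> b.
    apply: (@continuous_comp _ _ _ (fun b => dist_to S b - s) (fun r : R => `|r|)).
      apply: (@continuousB R R^o _ (dist_to S) (fun=> s)); first exact: cd.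
      exact: cst_continuous.
    exact: norm_continuous.
  by move=> b; apply: (@continuousD R R^o _ _ _ _ (c1 b) (c2 b)).
have Kp : K p by move: Sp; rewrite /S bnd_setCE// => -[].
have [b + bmin] := @compact_EVT_min _ R g _ (ex_intro _ p Kp) cK (continuous_subspaceT cg).
rewrite in_setE => Kb.
have gb e : 0 < e -> g b <= 2 * e.
  move=> e0; pose t := Num.max (s - e) (s / 2).
  have ts : t < s by rewrite gt_max; apply/andP; split; lra.
  have t0 : 0 < t by rewrite lt_max divr_gt0// orbT.
  have te : s - e <= t by rewrite le_max lexx.
  have [z Kz [dz zp]] := deep_point_near_bnd bK Sp t0 e0 (uniq t ts).
  apply: (@le_trans _ _ (g z)); first by apply: bmin; rewrite in_setE.
  rewrite /g dz ltr0_norm ?subr_lt0//; move: te zp; clear; lra.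
have g0 : g b <= 0.
  apply/ler_addgt0Pl => e e0; rewrite addr0.
  have e20 : 0 < e / 2 by rewrite divr_gt0.
  by have := gb (e / 2) e20; clear; lra.
have bp : dist_to S b <= enorm (b - p) := dist_to_le b cS Sp.
have db : dist_to S b = s.
  apply/eqP; rewrite -subr_eq0 -normr_le0.
  by move: g0 bp; rewrite /g; clear; lra.
exists b; last first.
  by move: g0; rewrite /g db subrr normr0 addr0 subr_le0.
move=> z; rewrite /eball/= => zb; apply: contrapT => Kz.
have [y Sy] := segment_meets_bnd clK Kb Kz.
by rewrite ltNge (le_trans _ (dist_to_le b cS Sy))// enorm_distC db.
Qed.

(** * Support functions, polar bodies and their centres *)

Definition supp {R : realType} {d : nat} (K : set 'rV[R]_d) (u : 'rV[R]_d) : R :=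
  sup [set dot u x | x in K].

Lemma supp_attained (R : realType) (d : nat) (K : set 'rV[R]_d) (u : 'rV[R]_d) :
  compact K -> K !=set0 ->
  exists p, [/\ K p, supp K u = dot u p & forall x, K x -> dot u x <= dot u p].
Proof.
move=> cK K0.
have [p + pmax] := @compact_EVT_max _ R (dot u) _ K0 cK
  (continuous_subspaceT (@dot_continuous R d u)).
rewrite in_setE => Kp.
have pm x : K x -> dot u x <= dot u p by move=> Kx; apply: pmax; rewrite in_setE.
exists p; split=> //; apply/eqP; rewrite eq_le; apply/andP; split.
  apply: ge_sup; first by exists (dot u p); exists p.
  by move=> _ [x Kx <-]; exact: pm.
apply: ub_le_sup; last by exists p.
by exists (dot u p) => _ [x Kx <-]; exact: pm.
Qed.

Lemma dot_le_supp (R : realType) (d : nat) (K : set 'rV[R]_d) (u x : 'rV[R]_d) :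
  compact K -> K x -> dot u x <= supp K u.
Proof.
move=> cK Kx; have K0 : K !=set0 by exists x.
by have [p [_ -> H]] := supp_attained u cK K0; exact: H.
Qed.

Lemma suppD (R : realType) (d : nat) (K : set 'rV[R]_d) (u v : 'rV[R]_d) :
  compact K -> K !=set0 -> supp K (u + v) <= supp K u + supp K v.
Proof.
move=> cK K0; have [p [Kp -> _]] := supp_attained (u + v) cK K0.
by rewrite dotDl lerD// dot_le_supp.
Qed.

Lemma suppZ (R : realType) (d : nat) (K : set 'rV[R]_d) (c : R) (u : 'rV[R]_d) :
  compact K -> K !=set0 -> 0 <= c -> supp K (c *: u) = c * supp K u.
Proof.
move=> cK K0 c0; apply/eqP; rewrite eq_le; apply/andP; split.
  have [p [Kp -> _]] := supp_attained (c *: u) cK K0.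
  by rewrite dotZl ler_wpM2l// dot_le_supp.
have [p [Kp -> _]] := supp_attained u cK K0.
by rewrite -dotZl dot_le_supp.
Qed.

Lemma supp_continuous (R : realType) (d : nat) (K : set 'rV[R]_d) :
  compact K -> K !=set0 -> continuous (supp K).
Proof.
move=> cK K0; have [M M0 KM] := compact_enorm_bounded cK.
apply: (@enorm_lipschitz_continuous _ _ M).
have H x y : supp K x - supp K y <= M * enorm (x - y).
  have [p [Kp -> _]] := supp_attained x cK K0.
  apply: (@le_trans _ _ (dot (x - y) p)).
    by rewrite dotBl lerD2l lerN2 dot_le_supp.
  by rewrite (le_trans (dot_le _ _))// mulrC ler_wpM2r ?enorm_ge0// KM.
move=> x y; rewrite ler_norml H andbT.
by rewrite lerNl opprB enorm_distC H.
Qed.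

(** The support point in direction [v] lies on the boundary, so a ball of radius
    [s] inside [K] passes through it; being inside [K], that ball has the same
    support value. *)
Lemma rolling_support (R : realType) (d : nat) (K : set 'rV[R]_d) (s : R)
    (v : 'rV[R]_d) :
  convex_body K -> rolling s K -> 0 < s -> v != 0 ->
  exists2 b, eball b s `<=` K & supp K v = dot v b + s * enorm v.
Proof.
move=> bK roll s0 v0; have [cK _ [i0 /interior_subset Ki0]] := bK.
have clK := compact_closed (@norm_hausdorff _ _) cK.
have [p [Kp pE pmax]] := supp_attained v cK (ex_intro _ _ Ki0).
have nv : 0 < enorm v by rewrite enorm_gt0.
have Sp : bnd (~` K) p.
  rewrite bnd_setCE//; split=> //; apply/closure_enormP => e e0.
  exists (p + (e / enorm v) *: v).
    move=> /pmax; rewrite dotDr dotZr dotvv gerDl leNgt => /negP; apply.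
    by rewrite mulr_gt0 ?divr_gt0// exprn_gt0.
  by rewrite addrAC subrr add0r enormZ gtr0_norm ?divr_gt0// divfK// gt_eqF.
have [b bK' bp] := rolling_ball bK roll s0 Sp.
exists b => //; apply/eqP; rewrite pE eq_le; apply/andP; split.
  rewrite -lerBlDl -dotBr (le_trans (dot_le _ _))// mulrC ler_wpM2r ?enorm_ge0//.
  by rewrite enorm_distC.
have Kq : K (b + (s / enorm v) *: v).
  apply: bK'; rewrite /eball/= addrAC subrr add0r enormZ gtr0_norm ?divr_gt0//.
  by rewrite divfK// gt_eqF.
have := pmax _ Kq; rewrite dotDr dotZr dotvv expr2 mulrA divfK// gt_eqF//.
Qed.

(** The gauge of the polar body of [K] about [a]. *)
Definition gauge {R : realType} {d : nat} (K : set 'rV[R]_d) (a u : 'rV[R]_d) : R :=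
  supp K u - dot u a.

Definition polar {R : realType} {d : nat} (K : set 'rV[R]_d) (a : 'rV[R]_d) :
    set 'rV[R]_d :=
  [set u | gauge K a u <= 1].

(** The inner parallel body of [K] at distance [s]. *)
Definition inner_centres {R : realType} {d : nat} (K : set 'rV[R]_d) (s : R) :
    set 'rV[R]_d :=
  [set b | eball b s `<=` K].

Lemma gauge_continuous (R : realType) (d : nat) (K : set 'rV[R]_d)
    (a : 'rV[R]_d) :
  compact K -> K !=set0 -> continuous (gauge K a).
Proof.
move=> cK K0; have -> : gauge K a = (fun u => supp K u - dot a u).
  by apply/funext => u; rewrite /gauge dotC.
move=> u; apply: (@continuousB R R^o _ (supp K) (dot a)).
  exact: supp_continuous.
exact: dot_continuous.
Qed.

Lemma gaugeZ (R : realType) (d : nat) (K : set 'rV[R]_d) (a u : 'rV[R]_d) (c : R) :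
  compact K -> K !=set0 -> 0 <= c -> gauge K a (c *: u) = c * gauge K a u.
Proof. by move=> cK K0 c0; rewrite /gauge suppZ// dotZl mulrBr. Qed.

Lemma gaugeD (R : realType) (d : nat) (K : set 'rV[R]_d) (a u v : 'rV[R]_d) :
  compact K -> K !=set0 -> gauge K a (u + v) <= gauge K a u + gauge K a v.
Proof.
move=> cK K0; rewrite /gauge dotDl opprD addrACA lerD2r; exact: suppD.
Qed.

Lemma dot_le_gauge (R : realType) (d : nat) (K : set 'rV[R]_d) (a b u : 'rV[R]_d) :
  compact K -> K b -> dot u (b - a) <= gauge K a u.
Proof. by move=> cK Kb; rewrite dotBr lerD2r dot_le_supp. Qed.

Lemma inner_centres_sub (R : realType) (d : nat) (K : set 'rV[R]_d) (s : R) :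
  0 <= s -> inner_centres K s `<=` K.
Proof. by move=> s0 b; apply; rewrite /eball/= subrr enorm0. Qed.

Lemma supp_inner_centre (R : realType) (d : nat) (K : set 'rV[R]_d)
    (b u : 'rV[R]_d) (s : R) :
  compact K -> 0 <= s -> inner_centres K s b ->
  dot u b + s * enorm u <= supp K u.
Proof.
move=> cK s0 bK.
have Kb := inner_centres_sub s0 bK.
have [->|u0] := eqVneq u 0.
  by rewrite enorm0 mulr0 addr0 dot_le_supp.
have nu : 0 < enorm u by rewrite enorm_gt0.
have Kq : K (b + (s / enorm u) *: u).
  apply: bK; rewrite /eball/= addrAC subrr add0r enormZ.
  by rewrite ger0_norm ?divr_ge0// ?(ltW nu)// divfK// gt_eqF.
have := dot_le_supp u cK Kq.
by rewrite dotDr dotZr dotvv expr2 mulrA divfK// gt_eqF.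
Qed.

Lemma gauge_inner_centre (R : realType) (d : nat) (K : set 'rV[R]_d)
    (b u : 'rV[R]_d) (s : R) :
  compact K -> 0 <= s -> inner_centres K s b -> s * enorm u <= gauge K b u.
Proof.
by move=> cK s0 /(supp_inner_centre u cK s0) H; rewrite /gauge lerBrDl.
Qed.

Lemma inner_centres_convex (R : realType) (d : nat) (K : set 'rV[R]_d) (s t : R)
    (a b : 'rV[R]_d) :
  convex_set (K : set (convex_lmodType 'rV[R]_d)) ->
  0 <= t -> t <= 1 -> inner_centres K s a -> inner_centres K s b ->
  inner_centres K s (a + t *: (b - a)).
Proof.
move=> /convex_setE vK t0 t1 aK bK w; rewrite /eball/= => wE.
pose e := w - (a + t *: (b - a)).
have -> : w = t *: (b + e) + (1 - t) *: (a + e).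
  by apply/rowP => i; rewrite !mxE; ring.
by apply: vK => //; [apply: bK|apply: aK]; rewrite /eball/= addrAC subrr add0r.
Qed.

Lemma polar_closed (R : realType) (d : nat) (K : set 'rV[R]_d) (a : 'rV[R]_d) :
  compact K -> K !=set0 -> closed (polar K a).
Proof.
move=> cK K0; apply: (@closed_comp _ _ (gauge K a) [set t | t <= 1]).
  by move=> u _; exact: gauge_continuous.
exact: closed_le.
Qed.

Lemma measurable_polar (R : realType) (d : nat) (K : set 'rV[R]_d) (a : 'rV[R]_d) :
  compact K -> K !=set0 -> measurable (polar K a : set (borel_rV R d)).
Proof. by move=> cK K0; apply: measurable_closed_rV; exact: polar_closed. Qed.

Lemma measurable_polar_cone (R : realType) (d : nat) (K : set 'rV[R]_d)
    (a b : 'rV[R]_d) :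
  compact K -> K !=set0 ->
  measurable ([set z | - (2 * gauge K a z) <= dot z (b - a)] : set (borel_rV R d)).
Proof.
move=> cK K0; apply: measurable_closed_rV.
have -> : [set z | - (2 * gauge K a z) <= dot z (b - a)] =
    (fun z => dot (b - a) z + 2 * gauge K a z) @^-1` [set t | 0 <= t].
  by apply/seteqP; split=> z; rewrite /= (dotC z); lra.
apply: closed_comp; last exact: closed_ge.
move=> z _; apply: (@continuousD R R^o _ (dot (b - a)) (fun z => 2 * gauge K a z)).
  exact: dot_continuous.
apply: (@continuousM R _ (fun=> 2) (gauge K a)); first exact: cst_continuous.
exact: gauge_continuous.
Qed.

Lemma lebesgue_polar_finite (R : realType) (d : nat) (K : set 'rV[R]_d)
    (a : 'rV[R]_d) (s : R) :
  compact K -> 0 < s -> inner_centres K s a ->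
  (lebesgue_rV R d (polar K a) < +oo)%E.
Proof.
move=> cK s0 aK.
have K0 : K !=set0 by exists a; exact: inner_centres_sub (ltW s0) _ aK.
apply: (@lebesgue_rV_bounded R d _ s^-1); first exact: measurable_polar.
move=> u; rewrite /polar/= => ua.
rewrite -[s^-1]mulr1 ler_pdivlMl//.
exact: le_trans (gauge_inner_centre u cK (ltW s0) aK) ua.
Qed.

Lemma lebesgue_polar_ge (R : realType) (d : nat) (K : set 'rV[R]_d) :
  compact K -> exists2 v : R, 0 < v &
    forall a, K a -> (v%:E <= lebesgue_rV R d (polar K a))%E.
Proof.
move=> cK; have [M M0 KM] := compact_enorm_bounded cK.
have M20 : 0 < (2 * M)^-1 by rewrite invr_gt0 mulr_gt0.
exists ((2 * M)^-1 ^+ d * kappa R d).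
  by rewrite mulr_gt0 ?exprn_gt0// kappa_gt0.
move=> a Ka; have K0 : K !=set0 by exists a.
rewrite -(lebesgue_rV_eball 0 M20); apply: le_measure; rewrite ?inE.
- exact: measurable_eball.
- exact: measurable_polar.
move=> u; rewrite /eball/= subr0 => uM; rewrite /polar/= /gauge.
have [p [Kp -> _]] := supp_attained u cK K0.
rewrite -dotBr (le_trans (dot_le _ _))//.
have pa : enorm (p - a) <= 2 * M.
  by rewrite (le_trans (enormD _ _))// enormN mulr2n mulrDl !mul1r lerD// KM.
rewrite (@le_trans _ _ ((2 * M)^-1 * (2 * M)))//.
  by apply: ler_pM => //; exact: enorm_ge0.
by rewrite mulVf// gt_eqF// mulr_gt0.
Qed.

Lemma bernoulli_ineq (R : realType) (n : nat) (x : R) :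
  -1 <= x -> 1 + n%:R * x <= (1 + x) ^+ n.
Proof.
move=> x1; elim: n => [|n IH]; first by rewrite mul0r addr0 expr0.
rewrite exprS; apply: (@le_trans _ _ ((1 + x) * (1 + n%:R * x))).
  rewrite -natr1; have : 0 <= n%:R * x ^+ 2 by rewrite mulr_ge0// sqr_ge0.
  by rewrite expr2; clear; lra.
by rewrite ler_wpM2l//; lra.
Qed.

(** A centre whose polar body has nearly least volume sees a fixed proportion of
    that body in the direction of every other centre [b]. Move from [a] towards
    [b] by the fraction [1 / (2 * d.+1)]: the part of the new polar body outside
    the cone has at most half the volume of the old body, and the part inside at
    most twice the volume of the old part inside. If the latter were small, the
    volume would decrease too much. *)
Lemma exists_polar_centre (R : realType) (d : nat) (K : set 'rV[R]_d.+1) (s : R) :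
  compact K -> convex_set (K : set (convex_lmodType 'rV[R]_d.+1)) ->
  0 < s -> inner_centres K s !=set0 ->
  exists2 a, inner_centres K s a & forall b, inner_centres K s b ->
    (5^-1%:E * lebesgue_rV R d.+1 (polar K a) <=
     lebesgue_rV R d.+1 (polar K a `&`
       [set z | (- (2 * gauge K a z) <= dot z (b - a))%R]))%E.
Proof.
move=> cK vK s0 [b0 b0K].
have sK := @inner_centres_sub R d.+1 K s (ltW s0).
have K0 : K !=set0 by exists b0; exact: sK.
pose L := lebesgue_rV R d.+1.
have fin a : inner_centres K s a -> L (polar K a) \is a fin_num.
  by move=> aK; rewrite ge0_fin_numE//; exact: lebesgue_polar_finite cK s0 aK.
have [v v0 Hv] := lebesgue_polar_ge cK.
pose A := [set fine (L (polar K a)) | a in inner_centres K s].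
have Av x : A x -> v <= x.
  by move=> [a aK <-]; rewrite -lee_fin fineK ?fin// Hv//; exact: sK.
have hA : has_inf A.
  split; first by exists (fine (L (polar K b0))); exists b0.
  by exists v => x /Av.
have m0 : 0 < inf A.
  by apply: (lt_le_trans v0); apply: lb_le_inf; [case: hA|move=> x /Av].
(* A near-minimizer up to the factor 10/9 suffices. *)
have [|_ [a aK <-] am] := @inf_adherent _ A (inf A / 9) _ hA.
  by rewrite divr_gt0.
exists a => // b bK.
set C := polar K a; set G := [set z | _].
have mC : measurable (C : set (borel_rV R d.+1)) by exact: measurable_polar.
have mG : measurable (G : set (borel_rV R d.+1)) by exact: measurable_polar_cone.
have mCG : measurable (C `&` G : set (borel_rV R d.+1)) by exact: measurableI.
pose g : R := (2 * d.+1%:R)^-1.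
have g0 : 0 < g by rewrite invr_gt0 mulr_gt0.
have g1 : g <= 1 / 2.
  by rewrite /g invfM div1r -[leRHS]mulr1 ler_wpM2l ?invr_ge0// invf_le1// ler1n.
have dg : d.+1%:R * g = 1 / 2.
  have : d.+1%:R != 0 :> R by rewrite pnatr_eq0.
  by rewrite /g; move: (d.+1%:R : R) => D D0; field.
pose a' := a + g *: (b - a).
have a'K : inner_centres K s a'.
  by apply: inner_centres_convex => //; [exact: ltW|lra].
pose c1 := 1 + 2 * g; pose c2 := 1 - g.
have c10 : 0 < c1 by rewrite /c1; lra.
have c20 : 0 < c2 by rewrite /c2; lra.
pose P1 : set (borel_rV R d.+1) := [set z | C (c1 *: (z : 'rV[R]_d.+1) + 0)].
pose P2 : set (borel_rV R d.+1) := [set z | (C `&` G) (c2 *: (z : 'rV[R]_d.+1) + 0)].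
have sub : polar K a' `<=` P1 `|` P2.
  move=> z; rewrite /polar/= => za'.
  have gE : gauge K a' z = gauge K a z - g * dot z (b - a).
    by rewrite /gauge /a' dotDr dotZr opprD addrA.
  have xle : dot z (b - a) <= gauge K a z by apply: dot_le_gauge => //; exact: sK.
  have [zG|zG] := leP (- (2 * gauge K a z)) (dot z (b - a)).
    right; rewrite /P2/= addr0; split.
      rewrite /C /polar/= gaugeZ// ?(ltW c20)//; apply: le_trans za'.
      rewrite gE /c2; have := ler_wpM2l (ltW g0) xle; lra.
    rewrite /G/= gaugeZ// ?(ltW c20)// dotZl mulrCA -mulrN.
    by rewrite ler_pM2l.
  left; rewrite /P1/= addr0 /C /polar/= gaugeZ// ?(ltW c10)//.
  apply: le_trans za'; rewrite gE /c1.
  by have := ler_wpM2l (ltW g0) (ltW zG); lra.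
have mP1 : measurable P1 by exact: measurable_preimage_affine.
have mP2 : measurable P2 by exact: measurable_preimage_affine.
have LP : (L (polar K a') <= L P1 + L P2)%E.
  rewrite (le_trans _ (measureU2 _ mP1 mP2))//.
  apply: le_measure; rewrite ?inE//; first exact: measurable_polar.
  exact: measurableU.
have finG : L (C `&` G) \is a fin_num.
  rewrite ge0_fin_numE//; apply: (@le_lt_trans _ _ (L C)).
    by apply: le_measure; rewrite ?inE// => z [].
  exact: lebesgue_polar_finite cK s0 aK.
move: LP; rewrite /P1 /P2 /L !lebesgue_rV_affine// -/L.
have yE := fineK (fin a aK); have qE := fineK finG; have y'E := fineK (fin a' a'K).
set y := fine (L (polar K a)) in yE am; set q := fine (L (C `&` G)) in qE.
set y' := fine (L (polar K a')) in y'E.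
rewrite -/C in yE; rewrite -yE -qE -y'E -!EFinM -EFinD !lee_fin.
have yy' : y <= 10 / 9 * y'.
  have : inf A <= y' by apply: ge_inf; [case: hA|exists a'].
  by move: am; clear; lra.
(* With [vol] the volume of the polar body, [9 / 10 vol <= vol / 2 + 2 q]. *)
have e1 : c1^-1 ^+ d.+1 <= 1 / 2.
  rewrite exprVn div1r lef_pV2 ?posrE ?exprn_gt0//.
  have := @bernoulli_ineq R d.+1 (2 * g) ltac:(lra).
  by rewrite mulrCA dg; apply: le_trans; lra.
have e2 : c2^-1 ^+ d.+1 <= 2.
  rewrite exprVn -[X in _ <= X]invrK lef_pV2 ?posrE ?exprn_gt0// ?invr_gt0//.
  have := @bernoulli_ineq R d.+1 (- g) ltac:(lra).
  by rewrite mulrN dg; apply: le_trans; lra.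
have y0 : 0 <= y by rewrite fine_ge0.
have q0 : 0 <= q by rewrite fine_ge0.
have := ler_wpM2r y0 e1; have := ler_wpM2r q0 e2.
by move: yy'; clear; lra.
Qed.

(** * Convex hulls of finitely many points *)

Definition simplex (R : realType) (n : nat) : set 'rV[R]_n :=
  [set c | (forall i, 0 <= c ord0 i) /\ \sum_i c ord0 i = 1].

Lemma simplex_compact (R : realType) (n : nat) : compact (@simplex R n).
Proof.
apply: (@closed_enorm_bounded_compact _ _ n%:R).
  have -> : @simplex R n = (\bigcap_(i in [set: 'I_n])
      ((fun c : 'rV[R]_n => c ord0 i) @^-1` [set t | 0 <= t])) `&`
      (dot (const_mx 1) @^-1` [set t | t = 1]).
    have sE (c : 'rV[R]_n) : dot (const_mx 1) c = \sum_i c ord0 i.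
      by apply: eq_bigr => i _; rewrite mxE mul1r.
    apply/seteqP; split=> c /=; rewrite sE => -[c0 c1]; split=> //.
      by move=> i _; exact: c0.
    by move=> i; exact: (c0 i I).
  apply: closedI.
    apply: closed_bigI => i _; apply: closed_comp; last exact: closed_ge.
    by move=> c _; exact: coord_continuous.
  apply: closed_comp; last exact: closed_eq.
  by move=> c _; exact: dot_continuous.
move=> c [c0 c1]; apply: (le_trans (enorm_le_norm c)).
rewrite -[leRHS]mulr1 ler_wpM2l// /Num.norm/= mx_normrE.
apply: bigmax_le => // -[i j] _ /=; rewrite (ord1 i) ger0_norm ?c0//.
by rewrite -c1 (bigD1 j)//= lerDl sumr_ge0.
Qed.

(** The convex hull of the rows of [M], parametrized by the compact set of
    barycentric coordinates. *)
Definition mxhull {R : realType} {n d : nat} (M : 'M[R]_(n, d)) : set 'rV[R]_d :=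
  [set c *m M | c in @simplex R n].

Lemma convex_combination (R : realType) (n d : nat) (A : set 'rV[R]_d)
    (c : 'I_n -> R) (x : 'I_n -> 'rV[R]_d) :
  convex_set (A : set (convex_lmodType 'rV[R]_d)) ->
  (forall i, 0 <= c i) -> \sum_i c i = 1 -> (forall i, A (x i)) ->
  A (\sum_i c i *: x i).
Proof.
move=> /convex_setE vA.
elim: n c x => [|n IH] c x c0 c1 Ax.
  by move: c1; rewrite big_ord0 => /esym/eqP; rewrite oner_eq0.
move: c1; rewrite !big_ord_recl => c1.
have s0 : 0 <= \sum_(i < n) c (lift ord0 i) by exact: sumr_ge0.
have [c01|c01] := eqVneq (c ord0) 1.
  have : \sum_(i < n) c (lift ord0 i) = 0 by move: c1; rewrite c01; lra.
  move=> /eqP; rewrite psumr_eq0// => /allP cz.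
  rewrite c01 scale1r big1 ?addr0// => i _.
  by have /eqP -> := cz i (mem_index_enum i); rewrite scale0r.
have c00 : 0 < 1 - c ord0.
  by rewrite lt_neqAle eq_sym subr_eq0 eq_sym c01/=; move: s0 c1; lra.
have -> : \sum_(i < n) c (lift ord0 i) *: x (lift ord0 i) =
    (1 - c ord0) *: \sum_(i < n) (c (lift ord0 i) / (1 - c ord0)) *: x (lift ord0 i).
  rewrite scaler_sumr; apply: eq_bigr => i _.
  by rewrite scalerA mulrCA divff ?mulr1// gt_eqF.
apply: vA => //; last by rewrite -subr_ge0 ltW.
apply: IH => // [i|]; first by rewrite divr_ge0// ltW.
rewrite -mulr_suml (_ : \sum_(i < n) _ = 1 - c ord0) ?divff ?gt_eqF//.
by move: c1; lra.
Qed.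

Lemma mxhull_convex (R : realType) (n d : nat) (M : 'M[R]_(n, d)) :
  convex_set (mxhull M : set (convex_lmodType 'rV[R]_d)).
Proof.
apply/convex_setE => _ _ t [c [c0 c1] <-] [c' [c'0 c'1] <-] t0 t1.
exists (t *: c + (1 - t) *: c').
  split=> [i|]; first by rewrite !mxE addr_ge0// mulr_ge0// subr_ge0.
  under eq_bigr do rewrite !mxE.
  by rewrite big_split/= -!mulr_sumr c1 c'1 !mulr1 addrC subrK.
by rewrite mulmxDl -!scalemxAl.
Qed.

Lemma convex_hullE (R : realType) (n d : nat) (x : 'I_n -> 'rV[R]_d) :
  convex_hull [set x i | i in [set: 'I_n]] = mxhull (\matrix_i x i).
Proof.
apply/seteqP; split.
  apply: smallest_sub; first exact: mxhull_convex.
  move=> _ [i _ <-]; exists (delta_mx ord0 i); last by rewrite -rowE rowK.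
  split=> [j|]; first by rewrite mxE; case: (_ && _).
  rewrite (bigD1 i)//= mxE !eqxx big1 ?addr0// => j ji.
  by rewrite mxE (negbTE ji) andbF.
move=> _ [c [c0 c1] <-] A [vA Ax].
rewrite mulmx_sum_row; apply: convex_combination => // i.
by rewrite rowK; apply: Ax; exists i.
Qed.

Lemma mxhull_compact (R : realType) (n d : nat) (M : 'M[R]_(n, d)) :
  compact (mxhull M).
Proof.
apply: continuous_compact; last exact: simplex_compact.
apply: continuous_subspaceT.
pose N := enorm (\row_i enorm (row i M)).
suff H c : enorm (c *m M) <= N * enorm c.
  move=> c; apply/(@cvgrPdist_lt _ _ _ (nbhs c) (nbhs_filter c)) => e e0.
  have N0 : 0 < N + 1 by rewrite ltr_wpDl// enorm_ge0.
  have : interior (eball c (e / (N + 1) / 2)) c.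
    by apply/interior_eball; exists (e / (N + 1) / 2); rewrite ?divr_gt0.
  apply: filterS => y; rewrite /eball/= => yc.
  apply: (le_lt_trans (norm_le_enorm _)); rewrite -mulmxBl.
  apply: (le_lt_trans (H _)).
  apply: (@le_lt_trans _ _ ((N + 1) * (e / (N + 1) / 2))).
    rewrite enorm_distC; apply: ler_pM => //; rewrite ?enorm_ge0//.
    by rewrite lerDl.
  rewrite mulrA mulrCA divff ?gt_eqF// mulr1.
  by rewrite ltr_pdivrMr// mulr_natr mulr2n ltrDl.
rewrite mulmx_sum_row.
apply: (@le_trans _ _ (\sum_i `|c ord0 i| * enorm (row i M))).
  elim/big_ind2 : _ => //; first by rewrite enorm0.
    by move=> a b a' b' ? ?; rewrite (le_trans (enormD _ _))// lerD.
  by move=> i _; rewrite enormZ.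
apply: (@le_trans _ _ (dot (\row_i `|c ord0 i|) (\row_i enorm (row i M)))).
  by rewrite /dot; apply: ler_sum => i _; rewrite !mxE.
rewrite (le_trans (dot_le _ _))// mulrC ler_wpM2l ?enorm_ge0//.
by rewrite /enorm; under eq_bigr do rewrite mxE real_normK ?num_real//.
Qed.

Lemma separating_direction (R : realType) (d : nat) (L : set 'rV[R]_d)
    (y : 'rV[R]_d) :
  compact L -> L !=set0 ->
  convex_set (L : set (convex_lmodType 'rV[R]_d)) -> ~ L y ->
  exists v, forall l, L l -> dot v l < dot v y.
Proof.
move=> cL L0 /convex_setE vL Ly.
have [l0 Ll0 lmin] := closest_point y cL L0.
pose v := y - l0.
have v0 : 0 < dot v v.
  rewrite dotvv exprn_gt0// enorm_gt0 subr_eq0; apply/eqP => yl.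
  by apply: Ly; rewrite yl.
exists v => l Ll.
suff : dot v (l - l0) <= 0.
  rewrite dotBr; have : dot v y = dot v v + dot v l0 by rewrite -dotDr subrK.
  by move: v0; clear; lra.
rewrite leNgt; apply/negP => p0.
pose w := l - l0; pose t := Num.min 1 (dot v w / (dot w w + 1)).
have w1 : 0 < dot w w + 1 by rewrite ltr_wpDl// dotvv_ge0.
have t0 : 0 < t by rewrite lt_min ltr01 divr_gt0.
have t1 : t <= 1 by rewrite ge_min lexx.
have tw : t * (dot w w + 1) <= dot v w.
  by rewrite -ler_pdivlMr// ge_min lexx orbT.
have := lmin _ (vL l l0 t Ll Ll0 (ltW t0) t1).
have -> : y - (t *: l + (1 - t) *: l0) = v - t *: w.
  by apply/rowP => i; rewrite !mxE; ring.
rewrite leNgt => /negP; apply.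
have pw : 0 < dot v w by [].
rewrite -/v; clearbody t v; clearbody w.
rewrite -(ltr_pXn2r (n := 2))// ?nnegrE ?enorm_ge0// -!dotvv.
rewrite !(dotBl, dotBr, dotZl, dotZr) (dotC w v).
have : t * (t * (dot w w + 1)) <= t * dot v w by rewrite ler_pM2l.
have : 0 < t * dot v w by rewrite mulr_gt0.
have : 0 < t * t by rewrite mulr_gt0.
by clear; nra.
Qed.

(** * From a bad direction to many missed directions *)

(** With [l = 1 - 15 / 8 * e], the ratio [l^-1] is smaller than [1 + 4 * e] for
    [e <= 1 / 4]; the inequality is strict because the event to be bounded is
    given by a non-strict one. *)
Lemma dL_lt (R : realType) (d : nat) (K L : set 'rV[R]_d) (a : 'rV[R]_d) (e : R) :
  convex_set (K : set (convex_lmodType 'rV[R]_d)) -> L `<=` K -> K a ->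
  0 < e -> e <= 1 / 4 ->
  (forall k, K k -> L (a + (1 - 15 / 8 * e) *: (k - a))) ->
  (dL L K < (4 * e)%:E)%E.
Proof.
move=> /convex_setE vK LK Ka e0 e4 KL.
set l := 1 - 15 / 8 * e in KL.
have l0 : 0 < l by rewrite /l; lra.
have l1 : l <= 1 by rewrite /l; lra.
have lE : (1 + (l^-1 - 1))^-1 = l by rewrite addrC subrK invrK.
apply: (@le_lt_trans _ _ (l^-1 - 1)%:E); last first.
  rewrite lte_fin ltrBlDr -(ltr_pM2r l0) mulVf ?gt_eqF// /l.
  by rewrite -subr_gt0; nra.
apply: ereal_inf_lbound; exists (l^-1 - 1) => //; split.
  by rewrite subr_ge0 invf_ge1.
exists a; rewrite lE; split.
  move=> _ [x Lx <-]; have -> : a + l *: (x - a) = l *: x + (1 - l) *: a.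
    by apply/rowP => i; rewrite !mxE; ring.
  by apply: vK => //; [exact: LK|exact: ltW].
move=> k Kk; exists (a + l *: (k - a)); first exact: KL.
have -> : 1 + (l^-1 - 1) = l^-1 by ring.
by apply/rowP => i; rewrite !mxE; field; rewrite gt_eqF.
Qed.

(** The directions [u] whose cap of [K] of Euclidean depth [h] avoids [L]. *)
Definition missed {R : realType} {d : nat} (K L : set 'rV[R]_d) (h : R) :
    set 'rV[R]_d :=
  [set u | forall l, L l -> dot u l < supp K u - h * enorm u].

(** One bad direction [v] forces a whole set of directions near [v] to be missed.
    If [u = v + e / 3 *: z] were hit by some [l] in [L], then [l] would nearly
    support [K] in direction [v] as well. The ball of centre [b] touches the
    support point in direction [v], so [supp K u] exceeds
    [dot u b + s * enorm u], and the loss is controlled by the gauge of [z]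
    alone, not by that of [- z], provided that [z] does not turn away from
    [b - a]. In units of the gauge of [v], each unit of [z] costs at most 4 (2 for
    the cone condition and 1 for each of the gauge of [z] and [s * enorm z]) and
    the depth of the cap costs [e / 2 * (1 + e / 3)]; the total
    [4 * (e / 3) + e / 2 * (1 + e / 3)] is at most [15 / 8 * e]. *)
Lemma missed_directions (R : realType) (d : nat) (K L : set 'rV[R]_d)
    (a k : 'rV[R]_d) (s e : R) :
  convex_body K -> rolling s K -> 0 < s -> inner_centres K s a ->
  0 < e -> e <= 1 / 4 ->
  compact L -> L !=set0 -> convex_set (L : set (convex_lmodType 'rV[R]_d)) ->
  L `<=` K -> K k -> ~ L (a + (1 - 15 / 8 * e) *: (k - a)) ->
  exists v b, [/\ gauge K a v = 1, inner_centres K s b &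
    forall z, polar K a z -> - (2 * gauge K a z) <= dot z (b - a) ->
      missed K L (e / 2 * s) (v + (e / 3) *: z)].
Proof.
move=> bK roll s0 aK e0 e4 cL L0 vL LK Kk Ly.
have [cK _ _] := bK.
have Ka := inner_centres_sub (ltW s0) aK.
have K0 : K !=set0 by exists a.
have [v0 sep] := separating_direction cL L0 vL Ly.
have v00 : v0 != 0.
  by apply/eqP => v00; have [l Ll] := L0; have := sep l Ll; rewrite v00 !dot0l ltxx.
have g0 : 0 < gauge K a v0.
  apply: lt_le_trans (gauge_inner_centre v0 cK (ltW s0) aK).
  by rewrite mulr_gt0// enorm_gt0.
pose v := (gauge K a v0)^-1 *: v0.
have vg : gauge K a v = 1.
  by rewrite /v gaugeZ ?invr_ge0 ?(ltW g0)// mulVf// gt_eqF.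
have vn0 : v != 0 by rewrite /v scaler_eq0 negb_or v00 andbT invr_eq0 gt_eqF.
have {}sep l : L l -> dot v l < dot v (a + (1 - 15 / 8 * e) *: (k - a)).
  by move=> /sep; rewrite /v !dotZl ltr_pM2l ?invr_gt0.
have [b bK' vb] := rolling_support bK roll s0 vn0.
exists v, b; split=> // z zg zb l Ll; rewrite ltNge; apply/negP => hit.
have := sep l Ll; rewrite ltNge => /negP; apply.
set u := v + _ in hit.
pose r := e / 3.
have r0 : 0 < r by rewrite divr_gt0.
have zg1 : gauge K a z <= 1 := zg.
have zs : s * enorm z <= gauge K a z := gauge_inner_centre z cK (ltW s0) aK.
have sz0 : 0 <= s * enorm z by rewrite mulr_ge0 ?enorm_ge0// ltW.
have ug : gauge K a u <= 1 + r * gauge K a z.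
  by rewrite (le_trans (gaugeD _ _ _ cK K0))// vg lerD2l gaugeZ// ltW.
have us : s * enorm u <= gauge K a u := gauge_inner_centre u cK (ltW s0) aK.
have ub := supp_inner_centre u cK (ltW s0) bK'.
have uvz : enorm v <= enorm u + r * enorm z.
  have -> : v = u - r *: z by rewrite /u addrK.
  by rewrite (le_trans (enormD _ _))// enormN enormZ gtr0_norm.
have suvz : s * enorm v <= s * enorm u + r * (s * enorm z).
  by rewrite mulrCA -mulrDr ler_wpM2l// ltW.
have zl : dot z l <= supp K z by apply: dot_le_supp => //; exact: LK.
have kv : dot v (k - a) <= 1 by rewrite -vg; exact: dot_le_gauge.
have dul : dot u l = dot v l + r * dot z l by rewrite /u dotDl dotZl.
have dub : dot u b = dot v b + r * dot z b by rewrite /u dotDl dotZl.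
have rzl : r * dot z l <= r * supp K z by rewrite ler_pM2l.
have rzb : r * (- (2 * gauge K a z)) <= r * (dot z b - dot z a).
  by rewrite ler_pM2l// -dotBr.
have rzg : r * gauge K a z <= r * 1 by rewrite ler_pM2l.
have rzs : r * (s * enorm z) <= r * gauge K a z by rewrite ler_pM2l.
have e2u : e / 2 * (s * enorm u) <= e / 2 * (1 + r).
  rewrite ler_pM2l ?divr_gt0// (le_trans us)// (le_trans ug)// lerD2l.
  by rewrite -[leRHS]mulr1.
have lk : (1 - 15 / 8 * e) * dot v (k - a) <= 1 - 15 / 8 * e.
  by rewrite -[leRHS]mulr1 ler_wpM2l//; lra.
have ee : e * e <= e / 4 by rewrite -[leRHS]mulr1 mulrAC -mulrA ler_pM2l//; lra.
rewrite dotDr dotZr.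
move: hit; rewrite -mulrA dul => hit.
have gz : r * gauge K a z = r * supp K z - r * dot z a by rewrite /gauge mulrBr.
have vgE : supp K v - dot v a = 1 := vg.
have er : e / 2 * (1 + r) = e / 2 + e * e / 6 by rewrite /r; field.
have rE : r = e / 3 by [].
move: hit ub suvz rzl rzb rzg rzs e2u lk ee gz vgE er rE vb dub.
rewrite !mulrN !mulrBr; clear -e0; lra.
Qed.

(** * Measurability of the event *)

(** Projection along a compact factor: this handles the existential quantifiers
    over homotheties and barycentric coordinates in the event. *)
Lemma closed_projection (T S : topologicalType) (C : set S) (Q : set (T * S)) :
  compact C -> closed Q -> closed [set t | exists2 s, C s & Q (t, s)].
Proof.
move=> cC cQ; rewrite -openC openE => t /= Ht.
have oQ : open (~` Q) by exact: closed_openC.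
move/compact_near_coveringP : cC => cC.
have := cC T (nbhs t) (fun t' s => ~ Q (t', s)) (nbhs_filter t).
have H s : C s -> \forall s' \near s & t' \near t, ~ Q (t', s').
  move=> Cs; have : nbhs (t, s) (~` Q).
    by apply: open_nbhs_nbhs; split=> // Qts; apply: Ht; exists s.
  case=> -[U V] /= [Ut Vs] UV; exists (V, U) => //= -[s' t'] /= [Vs' Ut'].
  exact: (UV (t', s')).
move=> /(_ H); apply: filterS => t' Ct' [s Cs Qs].
exact: (Ct' s Cs).
Qed.

Lemma continuous_rV (R : realType) (T : topologicalType) (d : nat)
    (f : T -> 'rV[R]_d) :
  (forall i, continuous (fun t => f t ord0 i)) -> continuous f.
Proof.
move=> cf t B [P HP PB].
have : nbhs t [set t' | forall j, P ord0 j (f t' ord0 j)].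
  by apply: filter_forall => j; apply: cf; exact: HP.
apply: filterS => t' H; apply: PB => i j; rewrite (ord1 i); exact: H.
Qed.

Lemma continuous_realD (R : realType) (T : topologicalType) (f g : T -> R) :
  continuous f -> continuous g -> continuous (fun t => f t + g t).
Proof. by move=> cf cg t; exact: (@continuousD R R^o _ _ _ _ (cf t) (cg t)). Qed.

Lemma continuous_realM (R : realType) (T : topologicalType) (f g : T -> R) :
  continuous f -> continuous g -> continuous (fun t => f t * g t).
Proof. by move=> cf cg t; exact: (@continuousM R _ _ _ _ (cf t) (cg t)). Qed.

Lemma continuous_realN (R : realType) (T : topologicalType) (f : T -> R) :
  continuous f -> continuous (fun t => - f t).
Proof. by move=> cf t; exact: (@continuousN R R^o _ _ _ (cf t)). Qed.

Lemma continuous_real_sum (R : realType) (T : topologicalType) (I : Type)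
    (r : seq I) (f : I -> T -> R) :
  (forall i, continuous (f i)) -> continuous (fun t => \sum_(i <- r) f i t).
Proof.
move=> cf; elim: r => [|i r IH].
  by under eq_fun do rewrite big_nil; exact: cst_continuous.
under eq_fun do rewrite big_cons; exact: continuous_realD.
Qed.

Lemma continuous_fst_snd (R : realType) (m n d : nat) :
  [/\ (forall i j, continuous (fun p : ('M[R]_(n, d) * ('rV[R]_d * R)) * 'rV[R]_m =>
         p.1.1 i j)),
      (forall j, continuous (fun p : ('M[R]_(n, d) * ('rV[R]_d * R)) * 'rV[R]_m =>
         p.1.2.1 ord0 j)),
      continuous (fun p : ('M[R]_(n, d) * ('rV[R]_d * R)) * 'rV[R]_m => p.1.2.2) &
      (forall j, continuous (fun p : ('M[R]_(n, d) * ('rV[R]_d * R)) * 'rV[R]_m =>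
         p.2 ord0 j))].
Proof.
have c1 : continuous (fun p : ('M[R]_(n, d) * ('rV[R]_d * R)) * 'rV[R]_m => p.1).
  by move=> p; exact: cvg_fst.
have c12 : continuous (fun p : ('M[R]_(n, d) * ('rV[R]_d * R)) * 'rV[R]_m => p.1.2).
  by move=> p; apply: (continuous_comp (c1 p)); exact: cvg_snd.
split=> [i j p|j p|p|j p].
- apply: (@continuous_comp _ _ _ (fun p : ('M[R]_(n, d) * ('rV[R]_d * R)) * 'rV[R]_m => p.1.1)
    (fun M : 'M[R]_(n, d) => M i j)); last exact: coord_continuous.
  by apply: (continuous_comp (c1 p)); exact: cvg_fst.
- apply: (@continuous_comp _ _ _ (fun p : ('M[R]_(n, d) * ('rV[R]_d * R)) * 'rV[R]_m => p.1.2.1)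
    (fun M : 'rV[R]_d => M ord0 j)); last exact: coord_continuous.
  by apply: (continuous_comp (c12 p)); exact: cvg_fst.
- by apply: (continuous_comp (c12 p)); exact: cvg_snd.
- apply: (@continuous_comp _ _ _ (fun p : ('M[R]_(n, d) * ('rV[R]_d * R)) * 'rV[R]_m => p.2)
    (fun M : 'rV[R]_m => M ord0 j)); last exact: coord_continuous.
  exact: cvg_snd.
Qed.

(** The condition under the infimum in [dL], with the ratio [l = (1 + e)^-1] in
    place of [e] so that it is polynomial, as a relation between the sample
    matrix and the pair [(a, l)]. *)
Definition squeezed {R : realType} {n d : nat} (K : set 'rV[R]_d) :
    set ('M[R]_(n, d) * ('rV[R]_d * R)) :=
  [set p | (forall c, @simplex R n c -> K (p.2.1 + p.2.2 *: (c *m p.1 - p.2.1))) /\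
           (forall k, K k -> exists2 c, @simplex R n c &
              p.2.1 + p.2.2 *: (k - p.2.1) = c *m p.1)].

Lemma squeezed_closed (R : realType) (n d : nat) (K : set 'rV[R]_d) :
  closed K -> closed (@squeezed R n d K).
Proof.
move=> cK.
have [cM ca cl cc] := @continuous_fst_snd R n n d.
have cmx j : continuous (fun p : ('M[R]_(n, d) * ('rV[R]_d * R)) * 'rV[R]_n =>
    (p.2 *m p.1.1) ord0 j).
  under eq_fun do rewrite mxE.
  apply: continuous_real_sum => i; exact: continuous_realM.
pose T := ('M[R]_(n, d) * ('rV[R]_d * R))%type.
have pairc (c : 'rV[R]_n) : continuous (fun p : T => (p, c)).
  move=> p B [[U V] /= [Up Vc] UV].
  apply: filterS Up => q Uq; apply: (UV (q, c)); split=> //=.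
  exact: nbhs_singleton Vc.
have cl1 : closed [set p : T | forall c, @simplex R n c ->
        K (p.2.1 + p.2.2 *: (c *m p.1 - p.2.1))].
  have -> : [set p : T | forall c, @simplex R n c ->
        K (p.2.1 + p.2.2 *: (c *m p.1 - p.2.1))] =
      \bigcap_(c in @simplex R n)
        ((fun p : T => p.2.1 + p.2.2 *: (c *m p.1 - p.2.1)) @^-1` K).
    by apply/seteqP; split=> p H c; exact: H.
  apply: closed_bigI => c _.
  have cF : continuous (fun p : T => p.2.1 + p.2.2 *: (c *m p.1 - p.2.1)).
    apply: continuous_rV => j.
    have -> : (fun t : T => (t.2.1 + t.2.2 *: (c *m t.1 - t.2.1)) ord0 j) =
        (fun t : T * 'rV[R]_n =>
           t.1.2.1 ord0 j + t.1.2.2 * ((t.2 *m t.1.1) ord0 j + - t.1.2.1 ord0 j))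
        \o (fun p : T => (p, c)).
      by apply/funext => t /=; rewrite !mxE.
    move=> p; apply: continuous_comp; first exact: pairc.
    apply: continuous_realD => //; apply: continuous_realM => //.
    by apply: continuous_realD => //; exact: continuous_realN.
  by apply: closed_comp => // p _; exact: cF.
suff cl2 : closed [set p : T | forall k, K k -> exists2 c, @simplex R n c &
      p.2.1 + p.2.2 *: (k - p.2.1) = c *m p.1] by exact: (closedI cl1 cl2).
have -> : [set p : T | forall k, K k -> exists2 c, @simplex R n c &
      p.2.1 + p.2.2 *: (k - p.2.1) = c *m p.1] =
    \bigcap_(k in K) [set p : T | exists2 c, @simplex R n c &
      [set q : T * 'rV[R]_n | forall j,
        (q.1.2.1 ord0 j + q.1.2.2 * (k ord0 j + - q.1.2.1 ord0 j)) -
        (q.2 *m q.1.1) ord0 j = 0] (p, c)].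
  apply/seteqP; split=> p H k Kk; have [c cs Hc] := H k Kk; exists c => //.
    by move=> j; rewrite -Hc !mxE subrr.
  apply/rowP => j; have := Hc j => /= /eqP; rewrite subr_eq0 => /eqP <-.
  by rewrite !mxE.
apply: closed_bigI => k _; apply: closed_projection; first exact: simplex_compact.
have -> : [set q : T * 'rV[R]_n | forall j,
        (q.1.2.1 ord0 j + q.1.2.2 * (k ord0 j + - q.1.2.1 ord0 j)) -
        (q.2 *m q.1.1) ord0 j = 0] = \bigcap_(j in [set: 'I_d])
     ((fun q : T * 'rV[R]_n =>
        (q.1.2.1 ord0 j + q.1.2.2 * (k ord0 j + - q.1.2.1 ord0 j)) +
        - (q.2 *m q.1.1) ord0 j) @^-1` [set t | t = 0]).
  by apply/seteqP; split=> p H j //=; exact: (H j I).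
apply: closed_bigI => j _; apply: closed_comp; last exact: closed_eq.
move=> q _; apply: continuous_realD; last exact: continuous_realN.
apply: continuous_realD => //; apply: continuous_realM => //.
apply: continuous_realD; first exact: cst_continuous.
exact: continuous_realN.
Qed.

Lemma dL_ltP (R : realType) (n d : nat) (K : set 'rV[R]_d) (M : 'M[R]_(n, d))
    (c : R) :
  (dL (mxhull M) K < c%:E)%E <->
  exists a l, [/\ (1 + c)^-1 < l, 0 < l, l <= 1, 0 < c & squeezed K (M, (a, l))].
Proof.
split=> [/ereal_inf_lt[_ [e [e0 [a [H1 H2]]] <-]]|[a [l [cl l0 l1 c0 [H1 H2]]]]].
  rewrite lte_fin => ec; have c0 : 0 < c by exact: le_lt_trans ec.
  have e10 : 0 < 1 + e by rewrite ltr_wpDr.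
  exists a, (1 + e)^-1; split=> //; rewrite ?invr_gt0//.
  - by rewrite ltf_pV2 ?posrE ?ltrD2l// (lt_trans e10)// ltrD2l.
  - by rewrite invf_le1// lerDl.
  split=> [s Ss|k Kk] /=; first by apply: H1; exists (s *m M) => //; exists s.
  have [_ [s Ss <-] <-] := H2 k Kk; exists s => //.
  by apply/rowP => i; rewrite !mxE; field; rewrite gt_eqF.
apply: (@le_lt_trans _ _ (l^-1 - 1)%:E).
  apply: ereal_inf_lbound; exists (l^-1 - 1) => //; split.
    by rewrite subr_ge0 invf_ge1.
  exists a; rewrite (_ : 1 + (l^-1 - 1) = l^-1) ?invrK; last by ring.
  split=> [_ [_ [s Ss <-] <-]|k Kk]; first exact: H1.
  have [s Ss Hs] := H2 k Kk; exists (s *m M); first by exists s.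
  rewrite -Hs /=; apply/rowP => i; rewrite !mxE; field; rewrite gt_eqF//.
by rewrite lte_fin ltrBlDl invf_plt ?posrE// addr_gt0.
Qed.

(** The complementary event is the union over [m] of the events that some
    homothety of centre in the ball of radius [m] and of ratio at least
    [(1 + c)^-1 + m.+1%:R^-1] is admissible: for each [m] a closed condition on
    the sample, since the homotheties range over a compact set. *)
Lemma measurable_dL_ge (R : realType) (n d : nat) (dO : measure_display)
    (O : measurableType dO) (X : 'I_n -> O -> 'rV[R]_d) (K : set 'rV[R]_d) (c : R) :
  closed K ->
  (forall i, measurable_fun [set: O] (X i : O -> borel_rV R d)) ->
  measurable [set w | (c%:E <= dL (convex_hull [set X i w | i in [set: 'I_n]]) K)%E].
Proof.
move=> cK mX.
pose M w : 'M[R]_(n, d) := \matrix_i X i w.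
have -> : [set w | (c%:E <= dL (convex_hull [set X i w | i in [set: 'I_n]]) K)%E] =
    ~` [set w | (dL (mxhull (M w)) K < c%:E)%E].
  apply/seteqP; split=> w /=; rewrite convex_hullE; first by move=> H; apply/negP; rewrite -leNgt.
  by move/negP; rewrite -leNgt.
apply: measurableC.
pose B (m : nat) : set ('rV[R]_d * R) :=
  eball 0 m%:R `*` `[(1 + c)^-1 + m.+1%:R^-1, 1]%classic.
pose F (m : nat) := [set N : 'M[R]_(n, d) | exists2 p, B m p & squeezed K (N, p)].
have [c0|c0] := leP c 0.
  rewrite (_ : [set w | _] = set0) // -subset0 => w /= /dL_ltP[a [l [_ _ _ + _]]].
  by rewrite ltNge c0.
have c10 : 0 < (1 + c)^-1 by rewrite invr_gt0 addr_gt0.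
have -> : [set w | (dL (mxhull (M w)) K < c%:E)%E] = \bigcup_m (M @^-1` F m).
  apply/seteqP; split=> w /=.
    move=> /dL_ltP[a [l [cl l0 l1 _ sq]]].
    have [m1 Hm1] := ltr_add_invr cl.
    pose m := maxn m1 (Num.trunc (enorm a)).+1.
    exists m => //; exists (a, l) => //; split.
      rewrite /eball/= subr0 ltW// (lt_le_trans (truncnS_gt _))// ler_nat.
      exact: leq_maxr.
    rewrite /= in_itv/= l1 andbT ltW// (le_lt_trans _ Hm1)// lerD2l.
    by rewrite lef_pV2 ?posrE// ler_nat ltnS leq_maxl.
  move=> [m _ [[a l] [_ /=]]]; rewrite in_itv/= => /andP[cl l1] sq.
  apply/dL_ltP; exists a, l; split=> //.
    by apply: lt_le_trans cl; rewrite ltrDl invr_gt0.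
  by apply: lt_le_trans cl; rewrite addr_gt0// invr_gt0.
apply: bigcupT_measurable => m.
have cF : closed (F m).
  apply: closed_projection; last exact: squeezed_closed.
  apply: compact_setX; last exact: segment_compact.
  apply: (@closed_enorm_bounded_compact _ _ m%:R); first exact: eball_closed.
  by move=> x; rewrite /eball/= subr0.
rewrite -(setCK (F m)) preimage_setC; apply: measurableC.
apply: (@measurable_preimage_open_mx R n d dO O M (~` F m)); last exact: closed_openC.
move=> i j; under eq_fun do rewrite mxE.
exact: (measurableT_comp (@measurable_coord R d j) (mX i)).
Qed.

(** * The tail bound for one body *)

Lemma convex_body_volume (R : realType) (d : nat) (K : set 'rV[R]_d) :
  convex_body K -> exists2 v : R, 0 < v & lebesgue_rV R d K = v%:E.
Proof.
move=> [cK _ [i0 /interior_eball[e e0 eK]]].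
have clK := compact_closed (@norm_hausdorff _ _) cK.
have mK : measurable (K : set (borel_rV R d)) by exact: measurable_closed_rV.
have [M _ KM] := compact_enorm_bounded cK.
have Koo := lebesgue_rV_bounded mK KM.
have K0 : (0 < lebesgue_rV R d K)%E.
  apply: (lt_le_trans (lebesgue_rV_eball_gt0 i0 e0)).
  by apply: le_measure; rewrite ?inE//; exact: measurable_eball.
exists (fine (lebesgue_rV R d K)); first by rewrite fine_gt0// K0.
by rewrite fineK// ge0_fin_numE.
Qed.

Lemma cap_of_body_volume (R : realType) (d : nat) (K : set 'rV[R]_d.+1)
    (s h : R) (u : 'rV[R]_d.+1) :
  convex_body K -> rolling s K -> 0 < s -> 0 < h -> h <= 1 ->
  ((s ^+ d.+1 * (kappa R d * (2 / d.+2%:R * Num.sqrt h ^+ d.+2)))%:E <=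
   lebesgue_rV R d.+1 (K `&`
     [set y | (supp K u - h * s * enorm u <= dot u (y : 'rV[R]_d.+1))%R]))%E.
Proof.
move=> bK roll s0 h0 h1.
have [cK _ [i0 /interior_subset Ki0]] := bK.
have clK := compact_closed (@norm_hausdorff _ _) cK.
have mK : measurable (K : set (borel_rV R d.+1)) by exact: measurable_closed_rV.
have mKcap r w : measurable (K `&` [set y | r <= dot w (y : 'rV[R]_d.+1)] : set (borel_rV R d.+1)).
  by apply: measurableI => //; exact: measurable_halfspace.
wlog u0 : u / u != 0.
  move=> H; have [u0|] := eqVneq u 0; last exact: H.
  have e0 : (const_mx 1 : 'rV[R]_d.+1) != 0.
    by apply/eqP => /rowP/(_ ord0); rewrite !mxE => /eqP; rewrite oner_eq0.
  apply: (le_trans (H _ e0)); apply: le_measure; rewrite ?inE//.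
  move=> y [Ky _]; split=> //=.
  rewrite u0 enorm0 mulr0 subr0 dot0l.
  have [p [_ -> _]] := supp_attained (0 : 'rV[R]_d.+1) cK (ex_intro _ _ Ki0).
  by rewrite dot0l.
have [b bK' bE] := rolling_support bK roll s0 u0.
apply: (le_trans (cap_volume b u0 s0 h0 h1)).
apply: le_measure; rewrite ?inE//.
  by apply: measurableI; [exact: measurable_eball|exact: measurable_halfspace].
move=> y [/= yb yu]; split=> /=; first exact: bK'.
by apply: le_trans yu; rewrite bE; lra.
Qed.

Lemma uniform_halfspace_le (R : realType) (d : nat) (dO : measure_display)
    (O : measurableType dO) (P : probability O R) (K : set 'rV[R]_d)
    (X : {RV P >-> borel_rV R d}) (v V : R) (H : set (borel_rV R d)) :
  uniform_on K X -> measurable (K : set (borel_rV R d)) ->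
  0 < v -> lebesgue_rV R d K = v%:E -> measurable H ->
  ((V * v)%:E <= lebesgue_rV R d (K `&` ~` H))%E ->
  (P (X @^-1` H) <= (1 - V)%:E)%E.
Proof.
move=> uX mK v0 Kv mH Hle; rewrite uX// lee_fin -lebesgue_rVE Kv/=.
rewrite ler_pdivrMr//.
have KE : (lebesgue_rV R d (H `&` K) + lebesgue_rV R d (K `&` ~` H) = v%:E)%E.
  rewrite -Kv -measureU//; [|exact: measurableI|by apply: measurableI => //; exact: measurableC|].
    by rewrite (setIC H) -setIUr setUv setIT.
  by rewrite -subset0 => y [[Hy _] [_]].
have fin (A : set (borel_rV R d)) : measurable A -> A `<=` K ->
    lebesgue_rV R d A = (fine (lebesgue_rV R d A))%:E.
  move=> mA AK; rewrite fineK// ge0_fin_numE//.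
  apply: (@le_lt_trans _ _ (lebesgue_rV R d K)); last by rewrite Kv ltry.
  by apply: le_measure; rewrite ?inE.
have f1 := fin (H `&` K) (measurableI _ _ mH mK) (@subIsetr _ _ _).
have f2 := fin (K `&` ~` H) (measurableI _ _ mK (measurableC mH)) (@subIsetl _ _ _).
move: KE Hle; rewrite f1 f2 -EFinD lee_fin => -[]/=.
by rewrite mulrBl mul1r; lra.
Qed.

(** A first-moment bound in which the measure of the set of missed directions
    plays the role usually played by the number of missed elements of a net.
    Let [C] be the polar body of [K] about a good centre. On the event, the
    missed directions inside [(1 + e / 3) C] have measure at least
    [5^-1 * (e / 3) ^+ d.+1 * vol C], by [missed_directions] and
    [exists_polar_centre]; by Tonelli the expectation of this measure is at most
    [(1 + e / 3) ^+ d.+1 * vol C * (1 - V) ^+ n], where [V] bounds from below the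
    probability that a point falls in a cap. *)
Lemma dL_tail_bound (R : realType) (d n : nat) (dO : measure_display)
    (O : measurableType dO) (P : probability O R) (K : set 'rV[R]_d.+1)
    (X : 'I_n -> {RV P >-> borel_rV R d.+1}) (s e v V : R) :
  (0 < n)%N -> convex_body K -> rolling s K -> 0 < s -> 0 < e -> e <= 1 / 4 ->
  iid_uniform K X -> 0 < v -> lebesgue_rV R d.+1 K = v%:E ->
  (forall u, ((V * v)%:E <= lebesgue_rV R d.+1 (K `&`
     [set y | (supp K u - e / 2 * s * enorm u <= dot u (y : 'rV[R]_d.+1))%R]))%E) ->
  (P [set w | (4 * e)%:E <= dL (sample_hull X w) K] <=
    (5 * (1 + 3 / e) ^+ d.+1 * (1 - V) ^+ n)%:E)%E.
Proof.
move=> n0 bK roll s0 e0 e4 [uX iX] v0 Kv capV.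
have [cK vK [i0 /interior_subset Ki0]] := bK.
have K0 : K !=set0 by exists i0.
have clK := compact_closed (@norm_hausdorff _ _) cK.
have mK : measurable (K : set (borel_rV R d.+1)) by exact: measurable_closed_rV.
have IC0 : inner_centres K s !=set0.
  have e10 : (const_mx 1 : 'rV[R]_d.+1) != 0.
    by apply/eqP => /rowP/(_ ord0); rewrite !mxE => /eqP; rewrite oner_eq0.
  by have [b bK' _] := rolling_support bK roll s0 e10; exists b.
have [a aK acen] := exists_polar_centre cK vK s0 IC0.
have Ka := inner_centres_sub (ltW s0) aK.
set L := lebesgue_rV R d.+1 in Kv capV acen.
set C := polar K a in acen.
have mC : measurable (C : set (borel_rV R d.+1)) by exact: measurable_polar.
have [c c0 Cc] : exists2 c : R, 0 < c & L C = c%:E.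
  have [c' c'0 /(_ _ Ka) Hc'] := lebesgue_polar_ge cK.
  have Coo := lebesgue_polar_finite cK s0 aK.
  exists (fine (L C)); last by rewrite fineK// ge0_fin_numE.
  by rewrite fine_gt0//; apply/andP; split=> //; apply: lt_le_trans Hc'.
pose r := e / 3.
have r0 : 0 < r by rewrite divr_gt0.
have r10 : 0 < 1 + r by rewrite addr_gt0.
pose D : set (borel_rV R d.+1) := [set u | C ((1 + r)^-1 *: (u : 'rV[R]_d.+1) + 0)].
have mD : measurable D by exact: measurable_preimage_affine.
have DE u : D u <-> gauge K a u <= 1 + r.
  rewrite /D/= addr0 /C /polar/= gaugeZ ?invr_ge0 ?(ltW r10)//.
  by rewrite ler_pdivrMl// mulr1.
have LD : L D = ((1 + r) ^+ d.+1 * c)%:E.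
  by rewrite /L lebesgue_rV_affine ?invr_gt0// invrK -/L Cc.
pose th (u : 'rV[R]_d.+1) := supp K u - e / 2 * s * enorm u.
have cth : continuous th.
  apply: continuous_realD; first exact: supp_continuous.
  apply: continuous_realN; apply: continuous_realM; first exact: cst_continuous.
  exact: enorm_continuous.
pose H u : set (borel_rV R d.+1) := [set y | dot u (y : 'rV[R]_d.+1) < th u].
have HC u : ~` H u = [set y | th u <= dot u (y : 'rV[R]_d.+1)].
  by apply/seteqP; split=> y /=; rewrite /H/= leNgt => /negP.
have mH u : measurable (H u).
  rewrite -(setCK (H u)) HC; apply: measurableC; exact: measurable_halfspace.
pose Q : set (O * borel_rV R d.+1) :=
  [set p | D p.2] `&` \bigcap_(i in [set: 'I_n]) [set p | H p.2 (X i p.1)].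
have mQ : measurable Q.
  apply: measurableI.
    by rewrite -[X in measurable X]setTI; exact: measurable_snd.
  apply: fin_bigcap_measurable => [|i _]; first exact: finite_finset.
  have -> : [set p : O * borel_rV R d.+1 | H p.2 (X i p.1)] =
      (fun p => dot (p.2 : 'rV[R]_d.+1) (X i p.1) - th p.2) @^-1` `]-oo, 0[%classic.
    by apply/seteqP; split=> p; rewrite /H/= in_itv/= subr_lt0.
  rewrite -[X in measurable X]setTI.
  apply: (_ : measurable_fun _ _) => //; apply: measurable_funB.
    apply: (@measurable_dot R d.+1 _ _ (fun p : O * borel_rV R d.+1 => p.2)
      (fun p => X i p.1)); first exact: measurable_snd.
    exact: (measurableT_comp (measurable_funPT (X i)) measurable_fst).
  exact: (measurableT_comp (measurable_continuous_rV cth) measurable_snd).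
have PX i : (P (X i @^-1` (~` K)) = 0)%E.
  by rewrite uX ?setICl -?lebesgue_rVE ?measure0 ?mul0r//; exact: measurableC.
pose N := \big[setU/set0]_(i < n) (X i @^-1` (~` K)).
have mXA i (A : set (borel_rV R d.+1)) : measurable A -> measurable (X i @^-1` A).
  by move=> mA; rewrite -[X in measurable X]setTI; exact: (measurable_funPT (X i)).
(* The sample lies in [K] only almost surely. *)
have [mN PN] : measurable N /\ P N = 0%E.
  rewrite /N; elim/big_ind : _ => [|A B [mA A0] [mB B0]|i _].
  - by split=> //; exact: measure0.
  - by split; [exact: measurableU|rewrite measureU0].
  - by split=> //; apply: mXA; exact: measurableC.
set E := [set w | _].
have mE : measurable E.
  exact: (@measurable_dL_ge R n d.+1 dO O (fun i w => X i w) K).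
have capP u : (P (ysection Q u) <= ((1 - V) ^+ n)%:E)%E.
  have mI : measurable (\bigcap_(i in [set: 'I_n]) (X i @^-1` H u)).
    by apply: fin_bigcap_measurable => [|i _]; [exact: finite_finset|exact: mXA].
  apply: (@le_trans _ _ (P (\bigcap_(i in [set: 'I_n]) (X i @^-1` H u)))).
    have mY : measurable (ysection Q u) := measurable_ysection u mQ.
    apply: le_measure; rewrite ?inE//.
    by move=> w; rewrite /ysection/= in_setE => -[_ Hw] i _; exact: (Hw i I).
  have := iX [set: 'I_n]%SET (fun=> H u) (fun=> mH u).
  have -> : [set` [set: 'I_n]%SET] = [set: 'I_n] by apply/seteqP; split=> i //=; rewrite inE.
  move=> ->.
  have HV i : (P (X i @^-1` H u) <= (1 - V)%:E)%E.
    by apply: (@uniform_halfspace_le _ _ _ _ _ K _ v) => //; rewrite HC; exact: capV.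
  have V1 : 0 <= 1 - V.
    by rewrite -lee_fin; apply: le_trans (HV (Ordinal n0)).
  have PE i : P (X i @^-1` H u) = (fine (P (X i @^-1` H u)))%:E.
    by rewrite fineK// fin_num_measure//; exact: mXA.
  rewrite (eq_bigr _ (fun i _ => PE i)) prodEFin lee_fin.
  have -> : (1 - V) ^+ n = \prod_(i in [set: 'I_n]%SET) (1 - V).
    by rewrite prodr_const cardsT card_ord.
  apply: ler_prod => i _; rewrite fine_ge0//= -lee_fin -PE; exact: HV.
have Qint : (\int[P]_w L (xsection Q w) <= ((1 - V) ^+ n * ((1 + r) ^+ d.+1 * c))%:E)%E.
  have V1 : 0 <= 1 - V.
    rewrite -lee_fin.
    have Hi := @uniform_halfspace_le _ _ _ _ P K _ v V (H 0) (uX (Ordinal n0)) mK v0 Kv (mH 0).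
    by apply: le_trans (Hi _); rewrite ?HC//; exact: capV.
  have k0 : (0 <= ((1 - V) ^+ n)%:E)%E by rewrite lee_fin exprn_ge0.
  rewrite measure_Tonelli// EFinM -LD.
  have -> : (((1 - V) ^+ n)%:E * L D = \int[L]_u (((1 - V) ^+ n)%:E * (\1_D u)%:E))%E.
    rewrite ge0_integralZl//; last exact: measurableT_comp.
    by rewrite integral_indic// setIT.
  apply: ge0_le_integral => //.
  - exact: (@measurable_fun_ysection _ _ _ _ _ P _ mQ).
  - by apply: measurable_funeM; exact: measurableT_comp.
  move=> u _ /=; rewrite indicE; have [uD|uD] := pselect (D u).
    by rewrite mem_set// mule1.
  rewrite memNset// mule0 (_ : ysection Q u = set0) ?measure0//.
  by rewrite -subset0 => w; rewrite /ysection/= in_setE => -[].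
have low w : E w -> ~ N w -> ((5^-1 * r ^+ d.+1 * c)%:E <= L (xsection Q w))%E.
  move=> Ew Nw.
  have XK i : K (X i w).
    apply: contrapT => XK; apply: Nw; rewrite /N.
    by rewrite -bigcup_seq /=; exists i => //=; rewrite mem_index_enum.
  have hE : sample_hull X w = mxhull (\matrix_i (X i w : 'rV[R]_d.+1)).
    by rewrite /sample_hull convex_hullE.
  have hX i : sample_hull X w (X i w) by move=> A [_]; apply; exists i.
  have hK : sample_hull X w `<=` K.
    by apply: smallest_sub => // _ [i _ <-]; exact: XK.
  have [k Kk Lk] : exists2 k, K k &
      ~ sample_hull X w (a + (1 - 15 / 8 * e) *: (k - a)).
    apply: contrapT => Hk; move: Ew; rewrite /E/= leNgt => /negP; apply.
    apply: (dL_lt vK hK Ka e0 e4) => k Kk.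
    by apply: contrapT => Lk; apply: Hk; exists k.
  have hcpt : compact (sample_hull X w) by rewrite hE; exact: mxhull_compact.
  have hcvx : convex_set (sample_hull X w : set (convex_lmodType 'rV[R]_d.+1)).
    by rewrite hE; exact: mxhull_convex.
  have h0 : sample_hull X w !=set0 by exists (X (Ordinal n0) w); exact: hX.
  have [u [b [ug bK' miss]]] :=
    missed_directions bK roll s0 aK e0 e4 hcpt h0 hcvx hK Kk Lk.
  have Hb := acen b bK'.
  set G := C `&` _ in Hb.
  have mG : measurable (G : set (borel_rV R d.+1)).
    by apply: measurableI => //; exact: measurable_polar_cone.
  pose W : set (borel_rV R d.+1) := [set y | G (r^-1 *: (y : 'rV[R]_d.+1) + - (r^-1 *: u))].
  have mW : measurable W by exact: measurable_preimage_affine.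
  have WE : L W = ((r ^+ d.+1)%:E * L G)%E.
    by rewrite /L lebesgue_rV_affine ?invr_gt0// invrK.
  apply: (@le_trans _ _ (L W)).
    rewrite WE (mulrC 5^-1) -mulrA EFinM lee_pmul2l//.
      by rewrite EFinM -Cc.
    by rewrite lte_fin exprn_gt0.
  have mX : measurable (xsection Q w) := measurable_xsection w mQ.
  apply: le_measure; rewrite ?inE//.
  move=> y [/= zC zG]; set z := _ + _ in zC zG.
  have yE : y = u + (e / 3) *: z :> 'rV[R]_d.+1.
    rewrite /z -scalerBr scalerA divff ?gt_eqF// scale1r addrC subrK//.
  rewrite /xsection/= in_setE; split=> /=.
    apply/DE; rewrite yE (le_trans (gaugeD _ _ _ cK K0))// ug lerD2l gaugeZ ?(ltW r0)//.
    by rewrite -[leRHS]mulr1 ler_pM2l.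
  move=> i _ /=; rewrite /H/= yE; apply: (miss z) => //; exact: hX.
have p00 : 0 < 5^-1 * r ^+ d.+1 * c by rewrite !mulr_gt0 ?exprn_gt0.
have mEN : measurable (E `\` N) by exact: measurableD.
have PEN : P E = P (E `\` N).
  apply/eqP; rewrite eq_le; apply/andP; split; last first.
    by apply: le_measure; rewrite ?inE// => w [].
  rewrite -(measureU0 mEN mN PN).
  have mU : measurable ((E `\` N) `|` N) by exact: measurableU.
  apply: le_measure; rewrite ?inE// => w Ew.
  by have [|] := pselect (N w); [right|left].
have low2 : ((5^-1 * r ^+ d.+1 * c)%:E * P (E `\` N) <= \int[P]_w L (xsection Q w))%E.
  rewrite -[X in (_ * P X)%E]setIT -integral_indic// -ge0_integralZl//; last 2 first.
    exact: measurableT_comp.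
    by rewrite lee_fin ltW.
  apply: ge0_le_integral => //.
  - by move=> w _; rewrite mule_ge0// lee_fin// ltW.
  - by apply: measurable_funeM; exact: measurableT_comp.
  - exact: (@measurable_fun_xsection _ _ _ _ _ L _ mQ).
  move=> w _ /=; rewrite indicE; have [wE|wE] := pselect ((E `\` N) w).
    by rewrite mem_set// mule1; case: wE => ? ?; exact: low.
  by rewrite memNset// mule0.
have := le_trans low2 Qint; rewrite -PEN.
have PEf : P E = (fine (P E))%:E by rewrite fineK// fin_num_measure.
rewrite PEf -EFinM !lee_fin => H1.
have rE : 1 + 3 / e = (1 + r) / r.
  by rewrite /r; field; rewrite gt_eqF.
rewrite rE expr_div_n -(ler_pM2l p00); apply: (le_trans H1).
rewrite le_eqVlt; apply/orP; left; apply/eqP.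
have rn : r ^+ d.+1 != 0 by rewrite expf_neq0// gt_eqF.
by move: rn; move: (r ^+ d.+1) ((1 + r) ^+ d.+1) ((1 - V) ^+ n) => A B Z A0; field.
Qed.

(** * Numerical estimates *)

Lemma powR_superadditive (R : realType) (p q z : R) :
  0 <= p -> 0 <= q -> 1 <= z -> p `^ z + q `^ z <= (p + q) `^ z.
Proof.
move=> p0 q0 z1; have z0 : 0 < z by exact: lt_le_trans z1.
have pq0 : 0 <= p + q by rewrite addr_ge0.
have z10 : 0 <= z - 1 by rewrite subr_ge0.
rewrite -!(@mulr_powRB1 _ _ z)// mulrDl; apply: lerD.
  by rewrite ler_wpM2l// ge0_ler_powR ?nnegrE// lerDl.
by rewrite ler_wpM2l// ge0_ler_powR ?nnegrE// lerDr.
Qed.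

Lemma ln2_ge (R : realType) : 1 / 2 <= ln 2 :> R.
Proof.
have := @le_ln1Dx R (- (1 / 2)) ltac:(lra).
have -> : 1 + - (1 / 2) = 2^-1 :> R by field.
by rewrite lnV ?posrE//; lra.
Qed.

(** Once [t * ln n / n] is at most 1/4, [n] is large, hence so is [ln n]. *)
Lemma mul_ln_ge3 (R : realType) (n : nat) (t : R) :
  (1 < n)%N -> 2 <= t -> t * ln n%:R / n%:R <= 1 / 4 -> 3 <= t * ln n%:R.
Proof.
move=> n1 t2.
have n0 : 0 < n%:R :> R by rewrite ltr0n ltnW.
rewrite ler_pdivrMr// => tn.
have l2 := ln2_ge R.
have step (k : nat) : (2 ^ k <= n)%N -> k%:R / 2 <= ln n%:R :> R.
  move=> kn; apply: (@le_trans _ _ (ln (2 ^+ k))).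
    rewrite lnXn// -[leRHS]mulr_natl ler_wpM2l//; lra.
  by rewrite ler_ln ?posrE ?exprn_gt0// -natrX ler_nat.
have grow (m : R) : 0 <= m -> m <= ln n%:R -> 8 * m <= n%:R.
  move=> m0 mn; have : 2 * m <= t * ln n%:R by apply: ler_pM => //; lra.
  by move: tn; lra.
have n4 : (2 ^ 2 <= n)%N.
  have := grow (1%:R / 2) ltac:(lra) (step 1%N n1).
  by rewrite -(ler_nat R) => H; apply: le_trans H; rewrite natrX; lra.
have n8 : (2 ^ 3 <= n)%N.
  have := grow (2%:R / 2) ltac:(lra) (step 2%N n4).
  by rewrite -(ler_nat R) => H; apply: le_trans H; rewrite natrX; lra.
have := step 3%N n8 => l3.
have : 2 * (3%:R / 2) <= t * ln n%:R by apply: ler_pM => //; lra.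
by lra.
Qed.

(** Writing [g = d.+1 * be], the lower bound
    [e `^ al >= t * ln n / n + x `^ al / n] turns [(1 - c * e `^ al) ^+ n] into at
    most [n `^ (- g) * expR (- (c * x `^ al))], because [c * t = g]. The factor
    [n `^ (- g)] absorbs [e ^- d.+1], since [e >= (t * ln n / n) `^ be], and
    leaves [(t * ln n) `^ g >= 3] to compensate the excess of
    [5 * (13 / 4) ^+ d.+1] over [6 ^+ d.+1]. *)
Lemma numeric_bound (R : realType) (d n : nat) (t x : R) :
  let al := (d.+1%:R + 1) / 2 in
  let be := 2 / (d.+1%:R + 1) in
  let c := 2 * d.+1%:R / ((d.+1%:R + 1) * t) in
  let e := (t * ln n%:R / n%:R) `^ be + n%:R `^ (- be) * x in
  (1 < n)%N -> 2 <= t -> 0 <= x -> e <= 1 / 4 ->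
  [/\ 0 < e, 0 <= c * e `^ al, c * e `^ al <= 1 &
   5 * (1 + 3 / e) ^+ d.+1 * (1 - c * e `^ al) ^+ n <=
   6 ^+ d.+1 * expR (- (c * x `^ al))].
Proof.
move=> al be c e n1 t2 x0 e4.
have n0 : 0 < n%:R :> R by rewrite ltr0n ltnW.
have t0 : 0 < t by lra.
pose D : R := d.+1%:R.
have D1 : 1 <= D by rewrite ler1n.
have D10 : D + 1 != 0 by rewrite gt_eqF//; lra.
have Dp : 0 < d.+1%:R + 1 :> R by rewrite ltr_wpDl.
have al1 : 1 <= al by rewrite /al -/D; lra.
have al0 : 0 < al by lra.
have be0 : 0 < be by rewrite divr_gt0.
have beal : be * al = 1 by rewrite /be /al -/D; field.
have ln0 : 0 < ln n%:R :> R by rewrite ln_gt0// ltr1n.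
pose w := t * ln n%:R / n%:R.
have w0 : 0 < w by rewrite !mulr_gt0// invr_gt0.
pose a := w `^ be.
have a0 : 0 < a by rewrite powR_gt0.
have aal : a `^ al = w by rewrite /a -powRrM beal powRr1// ltW.
have b0 : 0 < n%:R `^ (- be) by rewrite powR_gt0.
have bx0 : 0 <= n%:R `^ (- be) * x by rewrite mulr_ge0// ltW.
have ae : a <= e by rewrite /e lerDl.
have e0 : 0 < e by exact: lt_le_trans ae.
have w4 : w <= 1 / 4.
  rewrite -aal; apply: (@le_trans _ _ a).
    by apply: ge1r_powR => //; rewrite a0/=; move: e4 ae; clear; lra.
  exact: le_trans ae e4.
have tl3 : 3 <= t * ln n%:R by exact: mul_ln_ge3.
have c0 : 0 < c by rewrite divr_gt0// mulr_gt0.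
have c1 : c <= 1.
  rewrite ler_pdivrMr ?mulr_gt0//.
  by rewrite -/D mul1r; nra.
have eal1 : e `^ al <= 1.
  apply: (@le_trans _ _ e); last by move: e4; lra.
  by apply: ge1r_powR => //; rewrite e0/=; move: e4; lra.
have eal0 : 0 <= e `^ al by exact: powR_ge0.
have V0 : 0 <= c * e `^ al by rewrite mulr_ge0// ltW.
have V1 : c * e `^ al <= 1 by rewrite -[leRHS]mulr1 ler_pM// ltW.
split=> //.
pose g := D * be.
have g1 : 1 <= g by rewrite /g /be -/D mulrA ler_pdivlMr; lra.
have ct : c * t = g.
  have H (y : R) : y + 1 != 0 -> t != 0 -> 2 * y / ((y + 1) * t) * t = y * (2 / (y + 1)).
    by move=> y1 t1; field; rewrite ?y1 ?t1.
  by rewrite /c H// gt_eqF.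
have eal : w + n%:R^-1 * x `^ al <= e `^ al.
  apply: le_trans (powR_superadditive (ltW a0) bx0 al1).
  rewrite aal lerD2l powRM ?(ltW b0)// -powRrM mulNr beal.
  by rewrite powR_inv1// ltW.
have nV : g * ln n%:R + c * x `^ al <= n%:R * (c * e `^ al).
  have -> : g * ln n%:R + c * x `^ al = n%:R * (c * (w + n%:R^-1 * x `^ al)).
    by rewrite /w -ct; field; rewrite gt_eqF.
  by rewrite ler_pM2l// ler_pM2l.
have E1 : (1 - c * e `^ al) ^+ n <= expR (- (g * ln n%:R)) * expR (- (c * x `^ al)).
  rewrite -expRD -opprD; apply: (@le_trans _ _ (expR (- (c * e `^ al)) ^+ n)).
    rewrite lerXn2r ?nnegrE ?expR_ge0 ?subr_ge0//.
    by have := expR_ge1Dx (- (c * e `^ al)); rewrite addrC.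
  by rewrite -expRM_natl ler_expR mulrN lerN2.
have ng : expR (- (g * ln n%:R)) = (n%:R `^ g)^-1.
  by rewrite expRN /powR gt_eqF.
have ad : a ^+ d.+1 = (t * ln n%:R) `^ g / n%:R `^ g.
  rewrite -powR_mulrn ?(ltW a0)// /a -powRrM mulrC -/D -/g.
  by rewrite /w powRM ?mulr_ge0 ?invr_ge0 ?ltW// -powR_inv1 ?(ltW n0)// -!powRrM mulN1r powRN.
have E2 : (1 + 3 / e) ^+ d.+1 <= (13 / 4) ^+ d.+1 / a ^+ d.+1.
  rewrite -expr_div_n lerXn2r ?nnegrE//.
  - by rewrite addr_ge0// divr_ge0// ltW.
  - by rewrite divr_ge0// ltW.
  apply: (@le_trans _ _ (13 / 4 / e)); last by rewrite ler_pM2l// lef_pV2 ?posrE.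
  rewrite ler_pdivlMr// mulrDl mul1r divfK ?gt_eqF//.
  by move: e4; lra.
have tg : 3 <= (t * ln n%:R) `^ g.
  by apply: (le_trans tl3); apply: le1r_powR => //; lra.
have E3 : 5 * (13 / 4) ^+ d.+1 <= 6 ^+ d.+1 * 3 :> R.
  elim: (d) => [|k IH]; first by rewrite !expr1; lra.
  rewrite exprS [6 ^+ _]exprS.
  have : 0 <= 6 ^+ k.+1 :> R by rewrite exprn_ge0.
  by move: IH; lra.
have ngp : 0 < n%:R `^ g by rewrite powR_gt0.
have tgp : 0 < (t * ln n%:R) `^ g by exact: lt_le_trans tg.
apply: (@le_trans _ _ (5 * ((13 / 4) ^+ d.+1 / a ^+ d.+1) *
    (expR (- (g * ln n%:R)) * expR (- (c * x `^ al))))).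
  apply: ler_pM => //.
  - by rewrite mulr_ge0// exprn_ge0// addr_ge0// divr_ge0// ltW.
  - by rewrite exprn_ge0// subr_ge0.
  - by rewrite ler_pM2l.
rewrite [leLHS]mulrA ler_pM2r ?expR_gt0// ng ad.
have -> : 5 * ((13 / 4) ^+ d.+1 / ((t * ln n%:R) `^ g / n%:R `^ g)) / n%:R `^ g =
    5 * (13 / 4) ^+ d.+1 / (t * ln n%:R) `^ g.
  move: ngp tgp; move: (n%:R `^ g) ((t * ln n%:R) `^ g) (_ ^+ d.+1) => A B Z A0 B0.
  by field; rewrite !gt_eqF.
rewrite ler_pdivrMr//; apply: (le_trans E3).
by rewrite ler_pM2l// exprn_gt0.
Qed.

(** A half ball is a cap of height 1. *)
Lemma kappa_ratio_ge (R : realType) (d : nat) :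
  kappa R d * (2 / d.+2%:R) <= kappa R d.+1.
Proof.
have := @unit_cap_volume R d 1 ltr01 (lexx 1).
rewrite sqrtr1 expr1n mulr1 => H.
rewrite -lee_fin -lebesgue_rV_unit_ball; apply: (le_trans H).
apply: le_measure; rewrite ?inE; [|exact: measurable_eball|by move=> y []].
exact: measurable_axis_cap.
Qed.

Lemma tau_ge2 (R : realType) (d : nat) (r : R) :
  0 < r -> r <= 1 ->
  2 <= 2 `^ ((d.+1%:R + 1) / 2) * d.+1%:R * kappa R d.+1 / (r ^+ d.+1 * kappa R d).
Proof.
move=> r0 r1.
have k0 := kappa_gt0 R d; have k1 := kappa_gt0 R d.+1.
have D1 : 1 <= d.+1%:R :> R by rewrite ler1n.
have h1 : 2 <= 2 `^ ((d.+1%:R + 1) / 2) :> R.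
  by apply: le1r_powR; lra.
have h2 : kappa R d <= d.+1%:R * kappa R d.+1.
  apply: le_trans (ler_wpM2l _ (kappa_ratio_ge R d)) => //.
  rewrite mulrCA -[leLHS]mulr1 ler_pM2l// mulrA ler_pdivlMr//.
  by rewrite -natr1 mul1r; lra.
have h3 : r ^+ d.+1 <= 1 by rewrite exprn_ile1// ltW.
have r0' : 0 < r ^+ d.+1 by rewrite exprn_gt0.
rewrite ler_pdivlMr ?mulr_gt0// -mulrA.
apply: ler_pM => //; first by rewrite mulr_ge0// ltW.
by apply: le_trans h2; rewrite -[leRHS]mul1r ler_pM2r.
Qed.

(** The second term in the maximum defining [tau3] is made for this comparison
    with the volume of a cap of relative height [e / 2] of a ball of the rolling
    radius. *)
Lemma relative_cap_volume (R : realType) (d : nat) (r t v e : R) :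
  0 < r -> 0 < v -> 0 < e ->
  2 `^ ((d.+1%:R + 1) / 2) * d.+1%:R * kappa R d.+1 / (r ^+ d.+1 * kappa R d) <= t ->
  2 * d.+1%:R / ((d.+1%:R + 1) * t) * e `^ ((d.+1%:R + 1) / 2) * v <=
  (r * (v / kappa R d.+1) `^ (d.+1%:R^-1)) ^+ d.+1 *
    (kappa R d * (2 / d.+2%:R * Num.sqrt (e / 2) ^+ d.+2)).
Proof.
move=> r0 v0 e0 ht.
have k0 := kappa_gt0 R d; have k1 := kappa_gt0 R d.+1.
have D0 : 0 < d.+1%:R :> R by rewrite ltr0n.
have D10 : 0 < d.+1%:R + 1 :> R by rewrite ltr_wpDl.
have vk0 : 0 < v / kappa R d.+1 by rewrite divr_gt0.
have rE : ((v / kappa R d.+1) `^ (d.+1%:R^-1)) ^+ d.+1 = v / kappa R d.+1.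
  by rewrite -powR_mulrn ?powR_ge0// -powRrM mulVf ?gt_eqF// powRr1// ltW.
have sE : Num.sqrt (e / 2) ^+ d.+2 =
    e `^ ((d.+1%:R + 1) / 2) / 2 `^ ((d.+1%:R + 1) / 2).
  have e20 : 0 <= e / 2 by rewrite divr_ge0// ltW.
  have aE : 2^-1 * d.+2%:R = (d.+1%:R + 1) / 2 :> R by rewrite natr1 mulrC.
  rewrite -powR12_sqrt// -powR_mulrn ?powR_ge0// -powRrM aE.
  have h2 (z : R) : 2^-1 `^ z = (2 `^ z)^-1.
    by rewrite -powR_inv1// -powRrM mulN1r powRN.
  by rewrite powRM ?invr_ge0 ?(ltW e0)// h2.
rewrite exprMn rE sE.
have p0 : 0 < 2 `^ ((d.+1%:R + 1) / 2) :> R by rewrite powR_gt0.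
have rd0 : 0 < r ^+ d.+1 by rewrite exprn_gt0.
have q0 : 0 <= e `^ ((d.+1%:R + 1) / 2) by exact: powR_ge0.
have t0 : 0 < t.
  by apply: lt_le_trans ht; rewrite divr_gt0 ?mulr_gt0.
move: ht; rewrite ler_pdivrMr ?mulr_gt0// -[d.+2%:R]natr1.
move: p0 rd0 q0; move: (2 `^ _) (r ^+ d.+1) (e `^ _) => p rd q p0 rd0 q0.
move: D0 D10 k0 k1.
move: (d.+1%:R : R) (kappa R d) (kappa R d.+1) => D k k' D0 D10 k0 k'0 ht.
have [Dn pn kn tn] : [/\ D + 1 != 0, p != 0, k' != 0 & t != 0].
  by split; rewrite gt_eqF.
have -> : 2 * D / ((D + 1) * t) * q * v =
    (2 * q * v / ((D + 1) * t * (p * k'))) * (p * D * k').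
  by field; rewrite ?Dn ?pn ?kn ?tn.
have -> : rd * (v / k') * (k * (2 / (D + 1) * (q / p))) =
    (2 * q * v / ((D + 1) * t * (p * k'))) * (t * (rd * k)).
  by field; rewrite ?Dn ?pn ?kn ?tn.
apply: ler_wpM2l => //.
by rewrite divr_ge0 ?mulr_ge0// ltW.
Qed.

Lemma rolling_class_tail (R : realType) (d n : nat) (r t x : R)
    (dO : measure_display) (O : measurableType dO) (P : probability O R)
    (K : set 'rV[R]_d.+1) (X : 'I_n -> {RV P >-> borel_rV R d.+1}) :
  let e := (t * ln n%:R / n%:R) `^ (2 / (d.+1%:R + 1)) +
    n%:R `^ (- (2 / (d.+1%:R + 1))) * x in
  (1 < n)%N -> 0 < r -> r <= 1 -> rolling_class r K -> iid_uniform K X ->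
  2 `^ ((d.+1%:R + 1) / 2) * d.+1%:R * kappa R d.+1 / (r ^+ d.+1 * kappa R d) <= t ->
  0 <= x -> e <= 1 / 4 ->
  (P [set w | (4 * e)%:E <= dL (sample_hull X w) K] <=
   (6 ^+ d.+1 * expR (- (2 * d.+1%:R / ((d.+1%:R + 1) * t) *
      x `^ ((d.+1%:R + 1) / 2))))%R%:E)%E.
Proof.
move=> e n1 r0 r1 [bK roll] iX ht x0 e4.
have [v v0 Kv] := convex_body_volume bK.
have t2 : 2 <= t by exact: le_trans (tau_ge2 d r0 r1) ht.
have [e0 V0 V1 num] := numeric_bound n1 t2 x0 e4.
move: roll; rewrite -lebesgue_rVE Kv/= => roll.
have s0 : 0 < r * (v / kappa R d.+1) `^ (d.+1%:R^-1).
  by rewrite mulr_gt0// powR_gt0// divr_gt0// kappa_gt0.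
have e20 : 0 < e / 2 by rewrite divr_gt0.
have e21 : e / 2 <= 1 by move: e4; lra.
have capV u : ((2 * d.+1%:R / ((d.+1%:R + 1) * t) * e `^ ((d.+1%:R + 1) / 2) * v)%:E <=
    lebesgue_rV R d.+1 (K `&` [set y | (supp K u - e / 2 *
      (r * (v / kappa R d.+1) `^ (d.+1%:R^-1)) * enorm u <=
      dot u (y : 'rV[R]_d.+1))%R]))%E.
  apply: le_trans (cap_of_body_volume u bK roll s0 e20 e21).
  by rewrite lee_fin; exact: relative_cap_volume.
apply: (le_trans (dL_tail_bound (ltnW n1) bK roll s0 e0 e4 iX v0 Kv capV)).
by rewrite lee_fin.
Qed.

(* The sample under P_K is X K on the probability space (O K, P K); outside the
   class nothing is assumed about it. *)
Theorem theorem7 (R : realType) (d n : nat) (r : R)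
    (hd : (0 < d)%N) (hn : (0 < n)%N) (hr0 : 0 < r) (hr1 : r <= 1)
    (dO : set 'rV[R]_d -> measure_display)
    (O : forall K : set 'rV[R]_d, measurableType (dO K))
    (P : forall K : set 'rV[R]_d, probability (O K) R)
    (X : forall K : set 'rV[R]_d, 'I_n -> {RV (P K) >-> borel_rV R d})
    (hX : forall K : set 'rV[R]_d, rolling_class r K -> iid_uniform K (X K)) :
  let tau3 : R :=
    Num.max 1 (2 `^ ((d%:R + 1) / 2) * d%:R * kappa R d
               / (r ^+ d * kappa R d.-1)) in
  let c : R := 2 * d%:R / ((d%:R + 1) * tau3) in
  let a_n : R := (tau3 * ln n%:R / n%:R) `^ (2 / (d%:R + 1)) in
  let b_n : R := n%:R `^ (- (2 / (d%:R + 1))) in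
  forall x : R, 0 <= x -> a_n + b_n * x <= 1 / 4 ->
  (ereal_sup
     [set P K [set w | (4 * a_n + 4 * b_n * x)%R%:E <= dL (sample_hull (X K) w) K]
     | K in rolling_class r]
   <= (6 ^+ d * expR (- (c * x `^ ((d%:R + 1) / 2))))%R%:E)%E.
Proof.
case: d hd dO O P X hX => // d _ dO O P X hX tau3 c a_n b_n x x0 e4.
apply: ge_ereal_sup => _ [K KK <-].
have ht : 2 `^ ((d.+1%:R + 1) / 2) * d.+1%:R * kappa R d.+1 /
    (r ^+ d.+1 * kappa R d) <= tau3 by rewrite le_max lexx orbT.
have [n1|n1] := ltnP 1 n.
  rewrite -mulrA -mulrDr.
  exact: (rolling_class_tail n1 hr0 hr1 KK (hX K KK) ht x0 e4).
have nE : n = 1%N by apply/eqP; rewrite eqn_leq n1 hn.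
(* For a single point, [a_n = 0] and [b_n = 1], so that [x <= 1 / 4] and the
   right-hand side is at least 1. *)
have a0 : a_n = 0.
  by rewrite /a_n nE ln1 mulr0 mul0r powR0.
have b1 : b_n = 1 by rewrite /b_n nE powR1.
have x4 : x <= 1 / 4 by move: e4; rewrite a0 b1 add0r mul1r.
have D1 : 1 <= d.+1%:R :> R by rewrite ler1n.
have t2 : 2 <= tau3 by exact: le_trans (tau_ge2 d hr0 hr1) ht.
have c0 : 0 <= c by rewrite divr_ge0// mulr_ge0//; lra.
have c1 : c <= 1 by rewrite ler_pdivrMr ?mulr_gt0//; [nra|lra].
have al1 : 1 <= (d.+1%:R + 1) / 2 :> R by move: D1; lra.
have xal : x `^ ((d.+1%:R + 1) / 2) <= 1 / 4.
  have [->|xn0] := eqVneq x 0.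
    rewrite powR0; first by lra.
    by rewrite gt_eqF//; lra.
  apply: (le_trans _ x4); apply: ge1r_powR => //.
  by rewrite lt_def xn0 x0/=; lra.
have [[cK _ _] _] := KK.
have clK := compact_closed (@norm_hausdorff _ _) cK.
apply: (@le_trans _ _ 1%E).
  apply: probability_le1.
  exact: (@measurable_dL_ge R n d.+1 _ _ (fun i w => X K i w) K).
rewrite lee_fin.
have cx : c * x `^ ((d.+1%:R + 1) / 2) <= 1 * (1 / 4).
  by apply: ler_pM => //; exact: powR_ge0.
have E1 : 3 / 4 <= expR (- (c * x `^ ((d.+1%:R + 1) / 2))).
  by apply: le_trans (expR_ge1Dx _); lra.
have E2 : 6 <= 6 ^+ d.+1 :> R by rewrite ler_eXnr// ler1n.
apply: (@le_trans _ _ (6 * (3 / 4))); first by lra.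
by apply: ler_pM => //; lra.
Qed.
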